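(* There exist absolute constants $K<\infty$ and $c_0>0$ such that the following holds. Let $\eta\in(0,1]$ and let $(A,B,C)$ be an $\eta$-strictly admissible ordered triple of Lebesgue measurable subsets of $\mathbb{R}^1$ with finite, positive Lebesgue measures. Suppose that for some $\varepsilon\ge 0$ with $\varepsilon\le K^{-1}\eta^4$, $$\langle \mathbf{1}_A*\mathbf{1}_B,\,\mathbf{1}_{C}\rangle \ge \langle \mathbf{1}_{A^\star}*\mathbf{1}_{B^\star},\,\mathbf{1}_{C^\star}\rangle -\varepsilon \max(|A|,|B|,|C|)^2 .$$ Then $$\langle \mathbf{1}_A*\mathbf{1}_B,\mathbf{1}_C\rangle \le \langle \mathbf{1}_{A^\star}*\mathbf{1}_{B^\star},\mathbf{1}_{C^\star}\rangle - c_0 \eta^2 \inf_I |A\bigtriangleup I|^2,$$ where the infimum is taken over all bounded intervals $I\subset\mathbb{R}$.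
   Context: $|A|$ denotes Lebesgue measure of $A\subset\mathbb{R}$, $\mathbf{1}_A$ the indicator function of $A$, and $\langle f,g\rangle=\int_{\mathbb{R}} fg\,dm$ with $m$ Lebesgue measure; $*$ is convolution on $\mathbb{R}$. For a measurable set $S$ with $0<|S|<\infty$, $S^\star$ is the open interval centered at $0$ with $|S^\star|=|S|$. $S\bigtriangleup T$ is the symmetric difference. For $\eta\in(0,1]$, an ordered triple $(A_1,A_2,A_3)$ of measurable subsets of $\mathbb{R}^1$ with $0<|A_j|<\infty$ is $\eta$-strictly admissible if $|A_i|+|A_j|\ge |A_k|+\eta\max(|A_1|,|A_2|,|A_3|)$ for every permutation $(i,j,k)$ of $(1,2,3)$. *)

(* Defs.v *)
From HB Require Import structures.
From mathcomp Require Import all_boot all_order all_algebra.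
From mathcomp Require Import all_classical all_reals all_analysis.

Set Implicit Arguments.
Unset Strict Implicit.
Unset Printing Implicit Defensive.

Import Order.TTheory GRing.Theory Num.Theory.
Import numFieldNormedType.Exports.

Local Open Scope classical_set_scope.
Local Open Scope ring_scope.

(* The carrier of [completed_lebesgue_measure] is R equipped with the
   Caratheodory sigma-algebra, i.e. all Lebesgue measurable sets
   ([lebesgue_measure] only knows the Borel sets). *)
Definition lebesgue_measurable {R : realType} (A : set R) : Prop :=
  (@wlength R idfun)^*%mu.-cara.-measurable A.

(* |A|, meant for sets of finite measure: it is 0 when A has measure +oo. *)
Definition leb {R : realType} (A : set R) : R :=
  fine (completed_lebesgue_measure A).

Definition convolution {R : realType} (f g : R -> R) (x : R) : R :=
  \int[@completed_lebesgue_measure R]_y (f (x - y) * g y).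

Definition pairing {R : realType} (f g : R -> R) : R :=
  \int[@completed_lebesgue_measure R]_x (f x * g x).

Definition star {R : realType} (S : set R) : set R :=
  `](- (leb S / 2)), (leb S / 2)[.

Definition max_leb {R : realType} (A B C : set R) : R :=
  Num.max (Num.max (leb A) (leb B)) (leb C).

Definition finite_positive_measure {R : realType} (A : set R) : Prop :=
  lebesgue_measurable A /\ (0 < completed_lebesgue_measure A < +oo)%E.

(* Distinct i, j, k : 'I_3 are exactly the permutations of the indices. *)
Definition strictly_admissible {R : realType} (eta : R) (A1 A2 A3 : set R)
    : Prop :=
  let A := tnth [tuple A1; A2; A3] in
  (forall j, finite_positive_measure (A j)) /\
  (forall i j k : 'I_3, uniq [:: i; j; k] ->
     leb (A k) + eta * max_leb A1 A2 A3 <= leb (A i) + leb (A j)).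

Definition bounded_interval {R : realType} (I : set R) : Prop :=
  is_interval I /\ bounded_set I.

(* Main.v *)
Require Import Defs.
From HB Require Import structures.
From mathcomp Require Import all_boot all_order all_algebra.
From mathcomp Require Import all_classical all_reals all_analysis.
From mathcomp Require Import measurable_realfun ring lra.

Set Implicit Arguments.
Unset Strict Implicit.
Unset Printing Implicit Defensive.

Import Order.TTheory GRing.Theory Num.Theory.
Import numFieldNormedType.Exports.

Local Open Scope classical_set_scope.
Local Open Scope ring_scope.

(** Write a, b, c for the measures of A, B, C, let m be the largest of them and
    t = (a + b - c) / 2. The maximal value of the pairing is a b - t^2, and
    strict admissibility makes t, a - t and b - t at least eta m / 2. With D the
    deficit of (A, B, C), the point is to find an interval I such that
    |A + I| (symmetric difference) is O(sqrt D / eta).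

    On the line the inequality itself has a very short proof, and the proof
    leaves a remainder. Cut A at a point alpha with |A n [alpha, oo)| = t and B
    at a point beta with |B n (-oo, beta)| = t; call the four pieces A-, A+, B-,
    B+. The function g = 1_{A-} * 1_{B-} + 1_{A+} * 1_B is at most 1_A * 1_B,
    and it is also at most t, because it equals 1_A * 1_{B-} to the left of
    alpha + beta and 1_{A+} * 1_B to the right. Its integral is t (a + b - t).
    Comparing g with t on C and with 1_A * 1_B off C gives the inequality
    together with the information that t - g has integral at most D over C
    ([riesz_sobolev_cut]). For x in C to the left of alpha + beta this number
    t - g(x) is |(x - B-) \ A|; to the right it is |(x - A+) \ B|.

    Hence the part of C on the right, minus A+, lies in B up to an error D,
    so the inequality applied once more bounds the measure of that part by
    b - t + O(sqrt D). The part X of C on the left then has measure at least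
    a - t - O(sqrt D), and with Y = - B- the sumset X + Y lies in A up to an
    error D while |A| <= |X| + |Y| + O(sqrt D) ([near_sumset]). So A is close to
    a sumset of almost minimal measure.

    It remains to see that a sumset of almost minimal measure is almost an
    interval ([sumset_stability]). After discarding O(sqrt D) from X and Y, the
    translate of Y by each remaining point of X, and of X by each remaining
    point of Y, lies in A up to sqrt D, and the end points of the hulls of X and
    Y are such points. Suppose that the hull of Y is the longer one, of length
    l, and count modulo l. The translates of X by the two ends of Y agree modulo
    l, so A covers |X| twice. By continuity there are x in X and y in Y for
    which x + Y and X + y overlap modulo l in measure exactly |X| |Y| / l, the
    mean value of the overlap. Therefore
      |A| >= |X| + (|X| + |Y| - |X| |Y| / l) - O(sqrt D),
    which forces |X| (l - |Y|) = O(l sqrt D): the set Y almost fills its hull.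
    The translates of Y by the two ends of X then almost fill an interval, the
    hull of X being the shorter one, and that interval is the required I, with
    error O(sqrt D |Y| / |X|) = O(sqrt D / eta). *)

(** * Borel sets of finite measure, translates and reflections *)

Section borel.
Context {R : realType}.
Implicit Types (A B E X Y : set R) (r x : R).
Local Notation mu := (@lebesgue_measure R).

Definition translate r A : set R := [set x | A (x - r)].
Definition mirror r A : set R := [set x | A (r - x)].

Lemma measurable_translate r A : measurable A -> measurable (translate r A).
Proof.
move=> mA; rewrite -[translate r A]setTI.
by apply: (@measurable_funB _ _ R setT id (cst r)) => //; exact: measurable_id.
Qed.

Lemma measurable_mirror r A : measurable A -> measurable (mirror r A).
Proof.
move=> mA; rewrite -[mirror r A]setTI.
by apply: (@measurable_funB _ _ R setT (cst r) id) => //; exact: measurable_id.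
Qed.

Lemma mu_translate r A : measurable A -> mu (translate r A) = mu A.
Proof.
move=> mA; rewrite -[LHS]/(pushforward mu (fun x => x - r : measurableTypeR R) A).
apply/esym/lebesgue_measure_unique => //=.
  exact: measurable_funB.
move=> mf _ [[a b]] _ <- /=; rewrite /pushforward.
rewrite (_ : _ @^-1` _ = `]a + r, b + r]%classic).
  rewrite !lebesgue_measure_itv/= !lte_fin ltrD2r.
  by case: ifP => // _; rewrite -!EFinD; congr EFin; ring.
by apply/seteqP; split=> x /=; rewrite !in_itv/= ltrBrDr lerBlDr.
Qed.

Lemma mu_mirror r A : measurable A -> mu (mirror r A) = mu A.
Proof.
move=> mA; rewrite -(lebesgue_measureN mA).
rewrite -[RHS](@mu_translate r); last by rewrite -[X in measurable X]setTI;
  exact: oppr_measurable.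
by congr mu; apply/funext => x; rewrite /mirror /translate/= opprB.
Qed.

Definition finite_borel A := measurable A /\ (mu A < +oo)%E.

Lemma lebE A : finite_borel A -> (leb A)%:E = mu A.
Proof. by move=> [mA Afin]; rewrite /leb fineK// ge0_fin_numE. Qed.

Lemma leb_ge0 A : 0 <= leb A.
Proof. exact/fine_ge0/outer_measure_ge0. Qed.

Lemma finite_borel_sub A B : finite_borel B -> measurable A -> A `<=` B ->
  finite_borel A.
Proof.
by move=> [mB Bfin] mA AB; split=> //; apply: le_lt_trans Bfin;
  exact: le_outer_measure.
Qed.

Lemma finite_borelU A B : finite_borel A -> finite_borel B ->
  finite_borel (A `|` B).
Proof.
move=> [mA Afin] [mB Bfin]; split; first exact: measurableU.
by apply: (le_lt_trans (measureU2 _ _ _)) => //; rewrite lte_add_pinfty.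
Qed.

Lemma finite_borelI A B : finite_borel A -> measurable B ->
  finite_borel (A `&` B).
Proof.
by move=> fA mB; apply: (finite_borel_sub fA); [apply: measurableI => //;
  apply fA.1|exact: subIsetl].
Qed.

Lemma finite_borelIr A B : measurable A -> finite_borel B ->
  finite_borel (A `&` B).
Proof. by move=> mA fB; rewrite setIC; exact: finite_borelI. Qed.

Lemma finite_borelD A B : finite_borel A -> measurable B ->
  finite_borel (A `\` B).
Proof. by move=> fA mB; apply: finite_borelI => //; exact: measurableC. Qed.

Lemma finite_borel_translate r A : finite_borel A -> finite_borel (translate r A).
Proof. by move=> [mA Afin]; split;
  [exact: measurable_translate|rewrite mu_translate]. Qed.

Lemma finite_borel_mirror r A : finite_borel A -> finite_borel (mirror r A).
Proof. by move=> [mA Afin]; split;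
  [exact: measurable_mirror|rewrite mu_mirror]. Qed.

Lemma finite_borel_itv (b1 b2 : bool) (a b : R) :
  finite_borel [set` Interval (BSide b1 a) (BSide b2 b)].
Proof.
split; first exact: measurable_itv.
rewrite lebesgue_measure_itv/=.
by case: ifP => // _; rewrite -EFinD ltry.
Qed.

Lemma leb_itv (b1 b2 : bool) (a b : R) : a <= b ->
  leb [set` Interval (BSide b1 a) (BSide b2 b)] = b - a.
Proof.
move=> ab; have := lebE (finite_borel_itv b1 b2 a b).
rewrite lebesgue_measure_itv/= lte_fin.
move: ab; rewrite le_eqVlt => /orP[/eqP ->|->].
  by rewrite ltxx subrr => -[].
by rewrite -EFinD => -[].
Qed.

Lemma leb_translate r A : finite_borel A -> leb (translate r A) = leb A.
Proof.
by move=> fA; apply/EFin_inj; rewrite !lebE ?mu_translate//;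
  [exact: fA.1|exact: finite_borel_translate].
Qed.

Lemma leb_mirror r A : finite_borel A -> leb (mirror r A) = leb A.
Proof.
by move=> fA; apply/EFin_inj; rewrite !lebE ?mu_mirror//;
  [exact: fA.1|exact: finite_borel_mirror].
Qed.

Lemma le_leb A B : finite_borel A -> finite_borel B -> A `<=` B ->
  leb A <= leb B.
Proof. by move=> fA fB AB; rewrite -lee_fin !lebE//; exact: le_outer_measure. Qed.

Lemma leb_DI A B : finite_borel A -> measurable B ->
  leb A = leb (A `\` B) + leb (A `&` B).
Proof.
move=> fA mB; apply/EFin_inj; rewrite EFinD !lebE//.
- by apply: measureDI => //; exact: fA.1.
- exact: finite_borelI.
- exact: finite_borelD.
Qed.

Lemma leb_UI A B : finite_borel A -> finite_borel B ->
  leb (A `|` B) + leb (A `&` B) = leb A + leb B.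
Proof.
move=> fA fB; rewrite (leb_DI (finite_borelU fA fB) fA.1).
rewrite (leb_DI fB fA.1) setDUl setDv set0U [B `&` A]setIC.
rewrite (_ : (A `|` B) `&` A = A); last first.
  by apply/seteqP; split=> [x []|x Ax]//; split=> //; left.

by ring.
Qed.

Lemma leb_U_disj A B : finite_borel A -> finite_borel B -> A `&` B = set0 ->
  leb (A `|` B) = leb A + leb B.
Proof.
move=> fA fB AB0; rewrite -leb_UI// AB0.
by rewrite [leb set0](_ : _ = 0) ?addr0// /leb measure0.
Qed.

Lemma le_leb_U A B : finite_borel A -> finite_borel B ->
  leb (A `|` B) <= leb A + leb B.
Proof. by move=> fA fB; rewrite -leb_UI// lerDl leb_ge0. Qed.

End borel.

(** * Convolutions of indicator functions *)

Section tonelli.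
Context {R : realType}.
Implicit Types (A B E X Y : set R) (r x : R).
Local Notation mu := (@lebesgue_measure R).

(** The values are extended reals because [X] is also taken to be the complement
    of a set of finite measure; [convol (~` X) Y x] is |(x - Y) \ X|. *)
Definition convol X Y x : \bar R := mu (X `&` mirror x Y).

Let triple E X Y : set (R * R) := [set p | [/\ E p.1, X p.2 & Y (p.1 - p.2)]].

Let measurable_triple E X Y : measurable E -> measurable X -> measurable Y ->
  measurable (triple E X Y).
Proof.
move=> mE mX mY.
rewrite (_ : triple E X Y = (E `*` X) `&` ((fun p : R * R => p.1 - p.2) @^-1` Y)).
  apply: measurableI; first exact: measurableX.
  rewrite -[X in measurable X]setTI.
  by apply: (@measurable_funB _ _ R setT fst snd).
by apply/seteqP; split=> [p []//|p [[? ?] ?]].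
Qed.

Lemma measurable_convol X Y : measurable X -> measurable Y ->
  measurable_fun setT (convol X Y).
Proof.
move=> mX mY.
have := measurable_fun_xsection mu (measurable_triple measurableT mX mY).
congr measurable_fun; apply/funext => x /=; congr mu.
by apply/seteqP; split=> u; rewrite /xsection/= inE => //= -[].
Qed.

(** Tonelli: both sides are the measure of the pairs (x, u) with x in E, u in X
    and x - u in Y. *)
Lemma integral_convol E X Y : measurable E -> measurable X -> measurable Y ->
  (\int[mu]_(x in E) convol X Y x = \int[mu]_(u in X) mu (E `&` translate (u : R) Y))%E.
Proof.
move=> mE mX mY.
have := @indic_fubini_tonelli _ _ _ _ R mu mu _ (measurable_triple mE mX mY).
rewrite indic_fubini_tonelli_FE ?indic_fubini_tonelli_GE;
  try exact: measurable_triple.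
move=> H; rewrite [LHS]integral_mkcond [RHS]integral_mkcond.
under eq_integral => x _.
  rewrite (_ : _ x = mu (xsection (triple E X Y) x)); last first.
    rewrite patchE; case: ifPn => [/set_mem Ex|/negP nEx].
      by congr mu; apply/seteqP; split=> u; rewrite /xsection/= inE => //= -[].
    rewrite (_ : xsection _ _ = set0) ?measure0//; apply/seteqP; split=> u //.
    by rewrite /xsection/= inE => -[Ex _ _]; apply: nEx; exact/mem_set.
  over.
under [RHS]eq_integral => u _.
  rewrite (_ : _ u = mu (ysection (triple E X Y) u)); last first.
    rewrite patchE; case: ifPn => [/set_mem Xu|/negP nXu].
      by congr mu; apply/seteqP; split=> x; rewrite /ysection/= inE => //= -[].
    rewrite (_ : ysection _ _ = set0) ?measure0//; apply/seteqP; split=> x //.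
    by rewrite /ysection/= inE => -[_ Xu _]; apply: nXu; exact/mem_set.
  over.
exact: H.
Qed.

Lemma convolC X Y x : measurable X -> measurable Y -> convol X Y x = convol Y X x.
Proof.
move=> mX mY; rewrite /convol -(@mu_mirror _ x); last first.
  by apply: measurableI => //; exact: measurable_mirror.
by congr mu; apply/seteqP; split=> u; rewrite /mirror/= subKr => -[].
Qed.

Lemma integral_convol_total X Y : finite_borel X -> finite_borel Y ->
  (\int[mu]_x convol X Y x = (leb X * leb Y)%:E)%E.
Proof.
move=> fX fY; have [mX mY] := (fX.1, fY.1); rewrite integral_convol//.
transitivity (\int[mu]_(u in X) (leb Y)%:E)%E.
  by apply: eq_integral => u _; rewrite setTI mu_translate// lebE.
transitivity ((leb Y)%:E * mu X)%E; first exact: integral_cst.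
by rewrite -lebE// -EFinM mulrC.
Qed.
End tonelli.

(** * Cutting a set at a point of the line *)

Section quantile.
Context {R : realType}.
Implicit Types (A B E X Y : set R) (r x s : R).
Local Notation mu := (@lebesgue_measure R).

Definition below X r : set R := X `&` [set` `]-oo, r[].
Definition above X r : set R := X `&` [set` `[r, +oo[].

Lemma measurable_below X r : measurable X -> measurable (below X r).
Proof. by move=> mX; apply: measurableI. Qed.

Lemma measurable_above X r : measurable X -> measurable (above X r).
Proof. by move=> mX; apply: measurableI. Qed.

Lemma finite_borel_below X r : finite_borel X -> finite_borel (below X r).
Proof. by move=> fX; exact: finite_borelI. Qed.

Lemma finite_borel_above X r : finite_borel X -> finite_borel (above X r).
Proof. by move=> fX; exact: finite_borelI. Qed.

Lemma leb_below_above X r : finite_borel X ->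
  leb X = leb (below X r) + leb (above X r).
Proof.
move=> fX; rewrite (@leb_DI _ _ [set` `[r, +oo[])//; congr (leb _ + _).
by rewrite /below setDE setCitvr.
Qed.

Lemma leb_below_lipschitz X r r' : finite_borel X -> r <= r' ->
  leb (below X r) <= leb (below X r') <= leb (below X r) + (r' - r).
Proof.
move=> fX rr'; have sub : below X r `<=` below X r'.
  by move=> x [Xx]; rewrite /= !in_itv/= => xr; split=> //=;
    rewrite in_itv/= (lt_le_trans xr).
rewrite le_leb//=; try exact: finite_borel_below.
rewrite -(@leb_itv _ true false r r')//.
apply: le_trans (le_leb_U _ _); last 2 first.
- exact: finite_borel_below.
- exact: finite_borel_itv.
apply: le_leb; first exact: finite_borel_below.
  by apply: finite_borelU; [exact: finite_borel_below|exact: finite_borel_itv].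
move=> x [Xx /=]; rewrite !in_itv/= => xr'.
have [xr|rx] := ltP x r; first by left; split=> //=; rewrite in_itv/=.
by right; rewrite /= (ltW xr').
Qed.

(** The distribution function of [X] is Lipschitz, and a large bounded interval
    carries almost all of [X], so intermediate values are attained. *)
Lemma quantile X s : finite_borel X -> 0 < s < leb X ->
  exists r, leb (below X r) = s.
Proof.
move=> fX /andP[s0 sX].
have e0 : 0 < Num.min s (leb X - s) by rewrite lt_min s0 subr_gt0.
have [[a b]/= ab] := lebesgue_nearly_bounded fX.1 fX.2 e0.
have fD : finite_borel (X `\` [set` `[a, b]]) by exact: finite_borelD.
move: ab; rewrite -lebE// lte_fin lt_min => /andP[Ds DXs].
have la : leb (below X a) < s.
  apply: le_lt_trans Ds; apply: le_leb => //; first exact: finite_borel_below.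
  move=> x [Xx /=]; rewrite in_itv/= => xa; split=> //=.
  by rewrite in_itv/= leNgt xa.
have lb : s < leb (below X (Num.max a (b + 1))).
  have := leb_below_above (Num.max a (b + 1)) fX.
  suff : leb (above X (Num.max a (b + 1))) < leb X - s by lra.
  apply: le_lt_trans DXs; apply: le_leb => //; first exact: finite_borel_above.
  move=> x [Xx /=]; rewrite in_itv/= andbT ge_max => /andP[ax bx]; split=> //=.
  by rewrite in_itv/= => /andP[_ xb]; move: bx; rewrite leNgt ltr_pwDr.
have amax : a <= Num.max a (b + 1) by rewrite le_max lexx.
have [||r _ rE] := @IVT R (fun r => leb (below X r)) a (Num.max a (b + 1)) s amax.
- apply: continuous_subspaceT => x; apply/cvgrPdist_lt => e ee0.
  near=> y.
  have xy : `|x - y| < e by near: y; exact: cvgr_dist_lt.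
  have [le_xy|/ltW le_yx] := leP x y.
    have /andP[h1 h2] := leb_below_lipschitz fX le_xy.
    by move: xy; rewrite !ltr_norml => /andP[h3 h4]; apply/andP; split; lra.
  have /andP[h1 h2] := leb_below_lipschitz fX le_yx.
  by move: xy; rewrite !ltr_norml => /andP[h3 h4]; apply/andP; split; lra.
- by rewrite ge_min (ltW la)/= le_max (ltW lb) orbT.
by exists r.
Unshelve. all: by end_near. Qed.
End quantile.

(** * The Riesz-Sobolev inequality with a remainder *)

Section defect.
Context {R : realType}.
Implicit Types (A B E X Y : set R) (r x s : R).
Local Notation mu := (@lebesgue_measure R).

Lemma convol_ge0 X Y x : (0 <= convol X Y x)%E.
Proof. exact: outer_measure_ge0. Qed.

Lemma convol_setC X Y x : measurable X -> finite_borel Y ->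
  (convol X Y x + convol (~` X) Y x = (leb Y)%:E)%E.
Proof.
move=> mX fY; rewrite -(leb_mirror x fY) lebE; last exact: finite_borel_mirror.
rewrite /convol setIC [~` X `&` _]setIC -setDE addeC; apply/esym/measureDI => //.
exact: (finite_borel_mirror x fY).1.
Qed.

Lemma convol_setCr X Y x : finite_borel X -> measurable Y ->
  (convol X Y x + convol (~` Y) X x = (leb X)%:E)%E.
Proof.
by move=> fX mY; rewrite convolC ?convol_setC//; exact: fX.1.
Qed.

Section cut.
Variables (X Y : set R) (a b : R).
Hypotheses (mX : measurable X) (mY : measurable Y).

Let g x := (convol (below X a) (below Y b) x + convol (above X a) Y x)%E.

Let mXa := measurable_below a mX.
Let mXb := measurable_above a mX.
Let mYb := measurable_below b mY.

(** The two terms of [g] count disjoint sets of pairs. *)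
Lemma cut_le_convol x : (g x <= convol X Y x)%E.
Proof.
rewrite /g /convol -measureU; last first.
- by apply/seteqP; split=> u //= -[] [[_]] /=; rewrite in_itv/= => ua _ [[_]] /=;
  rewrite in_itv/= andbT leNgt ua.
- by apply: measurableI => //; exact: measurable_mirror.
- by apply: measurableI => //; exact: measurable_mirror.
apply: le_outer_measure => u [[[Xu _] []]|[[Xu _] ?]] //.
Qed.

(** If u >= a and x < a + b, then x - u < b: to the left of a + b the points of
    [X] above a only meet the part of [Y] below b. *)
Lemma cut_left x : x < a + b -> g x = convol X (below Y b) x.
Proof.
move=> xab; rewrite /g (_ : convol (above X a) Y x = convol (above X a) (below Y b) x).
  rewrite /convol -measureU; last first.
  - by apply/seteqP; split=> u //= -[] [[_]] /=;
    rewrite in_itv/= => ua _ [[_]] /=; rewrite in_itv/= andbT leNgt ua.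
  - by apply: measurableI => //; exact: measurable_mirror.
  - by apply: measurableI => //; exact: measurable_mirror.
  by rewrite -setIUl /below /above -setIUr -setCitvr setUC setUCr setIT.
congr mu; apply/seteqP; split=> u [[Xu ua]] //=; last by case.
move: ua; rewrite /= in_itv/= andbT => ua.
by move=> Yxu; split=> //; split=> //=; rewrite in_itv/= ?andbT//; lra.
Qed.

(** If u < a and x - u < b, then x < a + b: the first term of [g] vanishes to the
    right of a + b. *)
Lemma cut_right x : a + b <= x -> g x = convol (above X a) Y x.
Proof.
move=> xab; rewrite /g [convol (below _ _) _ _](_ : _ = 0%E) ?add0e// /convol.
rewrite (_ : _ `&` _ = set0) ?measure0//; apply/seteqP; split=> u // -[[_]].
by rewrite /= in_itv/= => ua [_ /=]; rewrite in_itv/= => ub; lra.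
Qed.
End cut.

(** With g as above, [s] minus g is the first integrand on the left part of [E]
    and the second one on the right part; off [E], g is bounded by [convol X Y].
    The total mass of g is (|X| - s) s + s |Y|. *)
Lemma riesz_sobolev_cut X Y E s : finite_borel X -> finite_borel Y ->
  finite_borel E -> 0 < s < leb X -> s < leb Y ->
  exists a b, [/\ leb (above X a) = s, leb (below Y b) = s &
   ((s * (leb X + leb Y - s))%:E
    + (\int[mu]_(x in below E (a + b)%R) convol (~` X) (below Y b) x
       + \int[mu]_(x in above E (a + b)%R) convol (~` Y) (above X a) x)
    <= (s * leb E)%:E + \int[mu]_(x in ~` E) convol X Y x)%E].
Proof.
move=> fX fY fE /andP[s0 sX] sY; have [mX mY mE] := And3 fX.1 fY.1 fE.1.
have [|a aE] := @quantile _ X (leb X - s) fX.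
  by apply/andP; split; lra.
have [|b bE] := @quantile _ Y s fY; first by rewrite s0.
have aE' : leb (above X a) = s by have := leb_below_above a fX; lra.
exists a, b; split=> //.
have fXa := finite_borel_above a fX; have fXb := finite_borel_below a fX.
have fYb := finite_borel_below b fY.
have [mXa mXb mYb] := And3 fXa.1 fXb.1 fYb.1.
set g := (fun x => convol (below X a) (below Y b) x + convol (above X a) Y x)%E.
set p := convol (~` X) (below Y b); set q := convol (~` Y) (above X a).
have mg : measurable_fun setT g.
  by apply: emeasurable_funD; exact: measurable_convol.
have mp : measurable_fun setT p.
  by apply: measurable_convol; [exact: measurableC|exact: fYb.1].
have mq : measurable_fun setT q.
  by apply: measurable_convol; [exact: measurableC|exact: fXa.1].
have g0 x : (0 <= g x)%E by rewrite adde_ge0// convol_ge0.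
have intg : (\int[mu]_x g x = (s * (leb X + leb Y - s))%:E)%E.
  rewrite ge0_integralD//; try exact: measurable_convol;
    try by move=> x _; exact: convol_ge0.
  rewrite !integral_convol_total// -EFinD aE aE' bE; congr EFin; ring.
have mEa := measurable_above (a + b)%R mE.
have mEb := measurable_below (a + b)%R mE.
have intp : (\int[mu]_(x in below E (a + b)%R) g x
    + \int[mu]_(x in below E (a + b)%R) p x = (s * leb (below E (a + b)%R))%:E)%E.
  rewrite -ge0_integralD //; try (by move=> x _; exact: convol_ge0);
    try exact: (measurable_funS measurableT).
  rewrite EFinM lebE; last exact: finite_borel_below.
  rewrite -integral_cst//; apply: eq_integral => x /set_mem[_].
  rewrite /= in_itv/= => xab; rewrite /g cut_left// /p convol_setC//.
  by rewrite bE.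
have intq : (\int[mu]_(x in above E (a + b)%R) g x
    + \int[mu]_(x in above E (a + b)%R) q x = (s * leb (above E (a + b)%R))%:E)%E.
  rewrite -ge0_integralD //; try (by move=> x _; exact: convol_ge0);
    try exact: (measurable_funS measurableT).
  rewrite EFinM lebE; last exact: finite_borel_above.
  rewrite -integral_cst//; apply: eq_integral => x /set_mem[_].
  rewrite /= in_itv/= andbT => xab; rewrite /g cut_right// /q convol_setCr//.
  by rewrite aE'.
have splitg : (\int[mu]_x g x = \int[mu]_(x in below E (a + b)%R) g x
    + \int[mu]_(x in above E (a + b)%R) g x + \int[mu]_(x in ~` E) g x)%E.
  have EE : E = below E (a + b)%R `|` above E (a + b)%R.
    by rewrite /below /above -setIUr -setCitvr setUC setUCr setIT.
  rewrite -(setUv E) ge0_integral_setU//.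
  - congr (_ + _)%E; rewrite {1}EE ge0_integral_setU//.
    + by rewrite -EE; exact: measurable_funS mg.
    + apply/disj_setPS => x [[_ /=]]; rewrite in_itv/= => xab [_ /=].
      by rewrite in_itv/= andbT leNgt xab.
  - exact: measurableC.
  - by rewrite setUv.
  - by apply/disj_setPS; rewrite setICr.
have le_gc : (\int[mu]_(x in ~` E) g x <= \int[mu]_(x in ~` E) convol X Y x)%E.
  apply: ge0_le_integral => //.
  - exact: measurableC.
  - exact: measurable_funS mg.
  - by apply: (measurable_funS measurableT) => //; exact: measurable_convol.
  - by move=> x _; exact: cut_le_convol.
rewrite -intg splitg (leb_below_above (a + b)%R fE) mulrDr EFinD -intp -intq.
by rewrite [X in (_ <= X + _)%E]addeACA [leLHS]addeAC leeD2l.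
Qed.

End defect.

(** * A near extremizer contains a large sumset *)

Section structure.
Context {R : realType}.
Implicit Types (A B C E X Y : set R) (r x s : R).
Local Notation mu := (@lebesgue_measure R).

(** The continuous form of Pollard's inequality: the right-hand side is minimal
    when [E] is the set where [convol X Y] exceeds [s], and its value is then the
    integral of min (convol X Y, s). *)
Lemma pollard X Y E s : finite_borel X -> finite_borel Y ->
  finite_borel E -> 0 < s < leb X -> s < leb Y ->
  ((s * (leb X + leb Y - s))%:E
    <= (s * leb E)%:E + \int[mu]_(x in ~` E) convol X Y x)%E.
Proof.
move=> fX fY fE sX sY; have [a [b [_ _]]] := riesz_sobolev_cut fX fY fE sX sY.
apply: le_trans; rewrite leeDl// adde_ge0// integral_ge0// => x _;
  exact: convol_ge0.
Qed.

Lemma integral_convol_setC A B C : finite_borel A -> finite_borel B ->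
  measurable C ->
  (\int[mu]_(x in C) convol A B x + \int[mu]_(x in ~` C) convol A B x
   = (leb A * leb B)%:E)%E.
Proof.
move=> fA fB mC; have mAB := measurable_convol fA.1 fB.1.
rewrite -integral_convol_total// -(setUv C) ge0_integral_setU//.
- exact: measurableC.
- by rewrite setUv.
- by apply/disj_setPS; rewrite setICr.
Qed.

Lemma translate_mirror0 x A : translate x (mirror 0 A) = mirror x A.
Proof. by apply/funext => u; rewrite /translate /mirror/= sub0r opprB. Qed.

(** The sets are X = C n (-oo, theta) and Y = - (B n (-oo, b)), where theta = a + b
    comes from the cut of A and B at level t. Since |C| is known, the lower bound
    for |X| is an upper bound for |C n [theta, oo)|, and [pollard] provides it. *)
Lemma near_sumset A B C t s : finite_borel A -> finite_borel B ->
  finite_borel C -> leb C = leb A + leb B - 2 * t ->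
  0 < t < leb A -> t < leb B -> 0 < s < t ->
  ((leb A * leb B - t ^+ 2 - s ^+ 2)%:E <= \int[mu]_(x in C) convol A B x)%E ->
  exists X Y, [/\ finite_borel X, finite_borel Y,
    leb A - t - 2 * s <= leb X <= leb C, leb Y = t &
    (\int[mu]_(x in X) mu (~` A `&` translate (x : R) Y) <= (s ^+ 2)%:E)%E].
Proof.
move=> fA fB fC cE tA tB /andP[s0 st] near.
have [mA mB mC] := And3 fA.1 fB.1 fC.1.
have [a [b [aE bE]]] := riesz_sobolev_cut fA fB fC tA tB.
have fAa := finite_borel_above a fA; have fBb := finite_borel_below b fB.
set X := below C (a + b); set Z := above C (a + b).
have fX : finite_borel X by exact: finite_borel_below.
have fZ : finite_borel Z by exact: finite_borel_above.
set IX := (\int[mu]_(x in X) _)%E; set IZ := (\int[mu]_(x in Z) _)%E => cut.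
have IX0 : (0 <= IX)%E by apply: integral_ge0 => x _; exact: convol_ge0.
have IZ0 : (0 <= IZ)%E by apply: integral_ge0 => x _; exact: convol_ge0.
have tot := integral_convol_setC fA fB mC.
have IXZ : (IX + IZ <= (s ^+ 2)%:E)%E.
  move: near tot cut.
  set P := (\int[mu]_(x in C) convol A B x)%E.
  set Q := (\int[mu]_(x in ~` C) convol A B x)%E.
  have P0 : (0 <= P)%E by apply: integral_ge0 => x _; exact: convol_ge0.
  have Q0 : (0 <= Q)%E by apply: integral_ge0 => x _; exact: convol_ge0.
  move: P Q IX IZ P0 Q0 IX0 IZ0 => [P| |] [Q| |] [IX| |] [IZ| |] //= P0 Q0 IX0 IZ0.
  rewrite -!EFinD !lee_fin => PE [QE]; rewrite cE; lra.
(* [pollard] for [Z] and the reflection of the right part of [A], tested on [B]. *)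
have leZ : leb Z <= leb B - t + 2 * s.
  have [Zs|sZ] := leP (leb Z) s; first by move: tB; lra.
  have fY : finite_borel (mirror 0 (above A a)) by exact: finite_borel_mirror.
  have := @pollard Z (mirror 0 (above A a)) B s fZ fY fB.
  rewrite s0 sZ leb_mirror// aE st => /(_ isT isT).
  rewrite integral_convol//; [|exact: measurableC|exact: fZ.1|exact: fY.1].
  under eq_integral do rewrite translate_mirror0.
  rewrite -/IZ => H.
  have : ((s * (leb Z + t - s))%:E <= (s * leb B + s ^+ 2)%:E)%E.
    rewrite EFinD; apply: (le_trans H); rewrite leeD2l//.
    by apply: le_trans IXZ; rewrite leeDr.
  by rewrite lee_fin expr2 -mulrDr ler_pM2l//; lra.
exists X, (mirror 0 (below B b)); split=> //.
- exact: finite_borel_mirror.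
- have := leb_below_above (a + b) fC; rewrite -/X -/Z => CE.
  by have := leb_ge0 Z => Z0; apply/andP; split; lra.
- by rewrite leb_mirror.
- under eq_integral do rewrite translate_mirror0.
  by apply: le_trans IXZ; rewrite leeDl.
Qed.

End structure.

(** * Continuity of the overlap of two translates *)

Section continuity.
Context {R : realType}.
Implicit Types (A B C E X Y : set R) (r x s : R).
Local Notation mu := (@lebesgue_measure R).

Lemma translateD r r' A : translate r (translate r' A) = translate (r + r') A.
Proof. by apply/funext => x; rewrite /translate /= opprD addrA. Qed.

Lemma compact_near_translate (K U : set R) : compact K -> open U -> K `<=` U ->
  \forall h \near (0 : R), translate h K `<=` U.
Proof.
move=> cK oU KU.
have /compact_near_coveringP/(_ R (nbhs (0 : R)) (fun h x => U (x + h))) := cK.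
move=> /(_ _) H.
have : \forall h \near (0 : R), forall x, K x -> U (x + h).
  apply: H => x Kx.
  have : (fun p : R * R => p.1 + p.2) @ (x, 0 : R) --> x + (0 : R).
    by apply: cvgD; [exact: cvg_fst|exact: cvg_snd].
  rewrite addr0 => /(_ U) /(_ _) [];
    first exact: open_nbhs_nbhs (conj oU (KU _ Kx)).
  by move=> [P Q] [/= Px Q0] PQ; exists (P, Q) => //= p; exact: PQ.
apply: filterS => h Kh x Kx; have := Kh _ Kx; by rewrite subrK.
Qed.

(** Squeeze [Y] between a compact set and an open set of nearly the same measure:
    small translates of the former stay inside the latter. *)
Lemma leb_translateD_near Y e : finite_borel Y -> 0 < e ->
  \forall h \near (0 : R), leb (translate h Y `\` Y) < e.
Proof.
move=> fY e0; have e3 : 0 < e / 3 by rewrite divr_gt0.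
have [K [cK KY YK]] := lebesgue_regularity_inner fY.1 fY.2 e3.
have mK := compact_measurable cK.
have fK : finite_borel K by exact: finite_borel_sub KY.
have [U [oU KU UK]] := lebesgue_regularity_outer fK.1 fK.2 e3.
have mU := open_measurable oU.
have fUK : finite_borel (U `\` K).
  by split; [exact: measurableD|apply: lt_trans UK _; exact: ltry].
have fYK : finite_borel (Y `\` K) by exact: finite_borelD.
apply: filterS (compact_near_translate cK oU KU) => h hK.
have fT : finite_borel (translate h (Y `\` K)) by exact: finite_borel_translate.
apply: (@le_lt_trans _ _ (leb (translate h (Y `\` K) `|` (U `\` K)))).
  apply: le_leb.
  - by apply: finite_borelD; [exact: finite_borel_translate|exact: fY.1].
  - exact: finite_borelU.
  - move=> x [Yx nYx]; have [Kx|nKx] := pselect (K (x - h)).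
      by right; split; [exact: hK|move=> /KY].
    by left.
apply: le_lt_trans (le_leb_U _ _) _ => //.
rewrite leb_translate//.
have h1 : leb (U `\` K) < e / 3 by rewrite -lte_fin lebE.
have h2 : leb (Y `\` K) < e / 3 by rewrite -lte_fin lebE.
lra.
Qed.

Lemma overlap_continuous X Y : finite_borel X -> finite_borel Y ->
  continuous (fun r => leb (X `&` translate r Y)).
Proof.
move=> fX fY r; apply/cvgrPdist_le => e e0.
have step r1 r2 : leb (X `&` translate r1 Y) <=
    leb (X `&` translate r2 Y) + leb (translate (r1 - r2) Y `\` Y).
  have f1 := finite_borel_translate r1 fY; have f2 := finite_borel_translate r2 fY.
  rewrite (_ : leb (_ `\` _) = leb (translate r1 Y `\` translate r2 Y)); last first.
    rewrite -(@leb_translate _ r2 (_ `\` _)); last first.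
      by apply: finite_borelD; [exact: finite_borel_translate|exact: fY.1].
    congr leb; apply/funext => x; rewrite /translate /=.
    by congr (Y _ /\ _); ring.
  apply: le_trans (le_leb_U _ _); last 2 first.
  - by apply: finite_borelI => //; exact: f2.1.
  - by apply: finite_borelD => //; exact: f2.1.
  apply: le_leb.
  - by apply: finite_borelI => //; exact: f1.1.
  - by apply: finite_borelU; [apply: finite_borelI => //;
    exact: f2.1|apply: finite_borelD => //; exact: f2.1].
  - by move=> x [Xx Yx]; have [?|?] := pselect (translate r2 Y x); [left|right].
have near1 : \forall h \near r, leb (translate (r - h) Y `\` Y) < e.
  have : (fun h => r - h) @ r --> (0 : R).
    by rewrite -(subrr r); apply: cvgB; [exact: cvg_cst|exact: cvg_id].
  by move=> /(_ _ (leb_translateD_near fY e0)).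
have near2 : \forall h \near r, leb (translate (h - r) Y `\` Y) < e.
  have : (fun h => h - r) @ r --> (0 : R).
    by rewrite -(subrr r); apply: cvgB; [exact: cvg_id|exact: cvg_cst].
  by move=> /(_ _ (leb_translateD_near fY e0)).
near=> h.
have h1 : leb (translate (r - h) Y `\` Y) < e by near: h.
have h2 : leb (translate (h - r) Y `\` Y) < e by near: h.
have := step r h; have := step h r; rewrite ler_norml => s1 s2.
by apply/andP; split; lra.
Unshelve. all: by end_near. Qed.

End continuity.

(** * Overlaps modulo a period *)

Section wrap.
Context {R : realType}.
Implicit Types (A B C E X Y : set R) (r x s : R).
Local Notation mu := (@lebesgue_measure R).

Definition overlap X Y r : R := leb (X `&` translate r Y).

Lemma leb_set0 : leb (set0 : set R) = 0.
Proof. by rewrite /leb measure0. Qed.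

Lemma integral_overlap E X Y : measurable E -> finite_borel X -> finite_borel Y ->
  (\int[mu]_(r in E) (overlap X Y r)%:E
   = \int[mu]_(x in X) mu (E `&` mirror (x : R) Y))%E.
Proof.
move=> mE fX fY; apply/esym.
have -> : (\int[mu]_(x in X) mu (E `&` mirror (x : R) Y)
  = \int[mu]_(x in X) convol E Y x)%E by [].
rewrite integral_convol//; [|exact: fX.1|exact: fY.1].
apply: eq_integral => r _; rewrite /overlap lebE//.
by apply: finite_borelI => //; exact: (finite_borel_translate r fY).1.
Qed.

Section fold.
Variables (X Y : set R) (x0 y0 l : R).
Hypotheses (fX : finite_borel X) (fY : finite_borel Y).
Hypotheses (X_itv : X `<=` [set` `[x0, x0 + l[]) (Y_itv : Y `<=`
  [set` `[y0, y0 + l[]).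

Let c := x0 - y0.
Let YY := Y `|` translate (- l) Y.

Let in_X x : X x -> x0 <= x < x0 + l.
Proof. by move=> /X_itv/=; rewrite in_itv. Qed.

Let in_Y x : Y x -> y0 <= x < y0 + l.
Proof. by move=> /Y_itv/=; rewrite in_itv. Qed.

Let fYl : finite_borel (translate (- l) Y).
Proof. exact: finite_borel_translate. Qed.

Let fYY : finite_borel YY.
Proof. exact: finite_borelU. Qed.

Lemma overlap_eq0 r : r <= c - l \/ c + l <= r -> overlap X Y r = 0.
Proof.
move=> rc; rewrite /overlap (_ : _ `&` _ = set0) ?leb_set0//.
apply/seteqP; split=> x //= [/in_X/andP[? ?]];
  rewrite /translate/= => /in_Y/andP[? ?].
by rewrite /c in rc; case: rc; lra.
Qed.

(** [Y] and its translate by - l are disjoint, as [Y] lies in a half-open interval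
    of length [l]. *)
Lemma overlap_fold r : overlap X YY r = overlap X Y r + overlap X Y (r - l).
Proof.
rewrite /overlap -leb_U_disj.
- by rewrite -setIUr; congr leb; congr (_ `&` _); apply/funext => x;
    rewrite /YY /translate /= /setU /=; congr (_ \/ Y _); ring.
- by apply: finite_borelI => //; exact: (finite_borel_translate _ fY).1.
- by apply: finite_borelI => //; exact: (finite_borel_translate _ fY).1.
- apply/seteqP; split=> x //= [[_]]; rewrite /translate/= => /in_Y/andP[? ?] [_].
  by move=> /in_Y/andP[? ?]; lra.
Qed.

(** The reflection of [Y] about a point of [X] lies in the two periods around c;
    the translated copy of [Y] brings the part in the lower period to the upper
    one. *)
Lemma leb_fold x : X x -> leb ([set` `[c, c + l[] `&` mirror x YY) = leb Y.
Proof.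
move=> /in_X/andP[x0x xx0].
have fmY := finite_borel_mirror x fY.
rewrite -(leb_mirror x fY) (leb_DI fmY (measurable_itv `[c, c + l[)).
rewrite -(@leb_translate _ l (_ `\` _)); last exact: finite_borelD.
rewrite -leb_U_disj.
- congr leb; apply/seteqP; split=> r /=; rewrite /mirror/translate/YY/=.
    move=> [rc [Yr|Yr]]; first by right.
    left; split; first by move: Yr; congr Y; ring.
    by rewrite !in_itv/= in rc *; move/andP: rc => [? ?] /andP[? ?]; lra.
  move=> [[Yr nr]|[Yr rc]]; last by split=> //; left.
  split; last by right; move: Yr; congr Y; ring.
  move: nr; rewrite !in_itv/= => /negP; rewrite negb_and -!ltNge => nr.
  move: Yr => /in_Y/andP[? ?]; rewrite /c in nr *.
  by case/orP: nr => nr; apply/andP; split; lra.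
- by apply/finite_borel_translate/finite_borelD.
- exact: finite_borelI.
- apply/seteqP; split=> r //= [[Yr nr] [Yr']]; rewrite in_itv/= => /andP[? ?].
  move: Yr Yr'; rewrite /translate /mirror/= => /in_Y/andP[? ?] /in_Y/andP[? ?];
    lra.
Qed.

(** The overlap modulo [l] is continuous in the shift and has mean |X| |Y| / l
    over a period, so it takes this value. The value being positive, the shift is
    a difference of a point of [X] and a point of [Y]. *)
Lemma exists_small_overlap : 0 < leb X -> 0 < leb Y -> 0 < l ->
  exists x y, [/\ X x, Y y & overlap X Y (x - y) + overlap X Y (x - y - l)
    + overlap X Y (x - y + l) = leb X * leb Y / l].
Proof.
move=> X0 Y0 l0.
have cl : c <= c + l by rewrite lerDl ltW.
have cov : continuous (overlap X YY) by exact: overlap_continuous.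
have co : {within `[c, c + l], continuous (overlap X YY)}.
  by exact: continuous_subspaceT.
have mov : measurable_fun setT (EFin \o overlap X YY).
  by apply/measurable_EFinP; exact: continuous_measurable_fun.
set T := [set` `[c, c + l[].
have T_in r : T r -> r \in `[c, c + l].
  by rewrite /T/= !in_itv/= => /andP[-> /ltW ->].
have intT : (\int[mu]_(r in T) (overlap X YY r)%:E = (leb X * leb Y)%:E)%E.
  rewrite integral_overlap//; last exact: measurable_itv.
  transitivity (\int[mu]_(x in X) (leb Y)%:E)%E.
    apply: eq_integral => x /set_mem Xx; rewrite -lebE ?leb_fold//.
    apply: finite_borelIr; first exact: measurable_itv.
    exact: finite_borel_mirror.
  transitivity ((leb Y)%:E * mu X)%E; first by apply: integral_cst; exact: fX.1.
  by rewrite -lebE// -EFinM mulrC.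
have muT k : (\int[mu]_(r in T) k%:E = (k * l)%:E)%E.
  transitivity (k%:E * mu T)%E; first by apply: integral_cst; exact: measurable_itv.
  rewrite -lebE ?leb_itv// ?EFinM; last exact: finite_borel_itv.
  by rewrite addrAC subrr add0r.
have [c1 c1T min1] := EVT_min cl co; have [c2 c2T max2] := EVT_max cl co.
have le1 : overlap X YY c1 * l <= leb X * leb Y.
  rewrite -lee_fin -intT -muT; apply: ge0_le_integral => //.
  - exact: measurable_itv.
  - by move=> r _; rewrite lee_fin leb_ge0.
  - exact: measurable_funS mov.
  - by move=> r Tr; rewrite lee_fin min1// T_in.
have le2 : leb X * leb Y <= overlap X YY c2 * l.
  rewrite -lee_fin -intT -muT; apply: ge0_le_integral => //.
  - exact: measurable_itv.
  - by move=> r _; rewrite lee_fin leb_ge0.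
  - exact: measurable_funS mov.
  - by move=> r Tr; rewrite lee_fin max2// T_in.
have v0 : 0 < leb X * leb Y / l by rewrite divr_gt0// mulr_gt0.
have [r rT rE] : exists2 r, r \in `[c, c + l] & overlap X YY r = leb X * leb Y / l.
  have lev1 : overlap X YY c1 <= leb X * leb Y / l by rewrite ler_pdivlMr.
  have lev2 : leb X * leb Y / l <= overlap X YY c2 by rewrite ler_pdivrMr.
  rewrite !in_itv/= in c1T c2T; move: c1T c2T => /andP[? ?] /andP[? ?].
  have [c12|/ltW c21] := leP c1 c2.
    have [||r] := @IVT R (overlap X YY) c1 c2 (leb X * leb Y / l) c12.
    - by exact: continuous_subspaceT.
    - by rewrite ge_min lev1 le_max lev2 orbT.
    - by rewrite in_itv/= => /andP[? ?] rE; exists r => //; rewrite in_itv/=;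
      apply/andP; split; lra.
  have [||r] := @IVT R (overlap X YY) c2 c1 (leb X * leb Y / l) c21.
  - by exact: continuous_subspaceT.
  - by rewrite ge_min lev1 le_max lev2 orbT.
  - by rewrite in_itv/= => /andP[? ?] rE; exists r => //; rewrite in_itv/=;
    apply/andP; split; lra.
have [u [Xu Yu]] : (X `&` translate r YY) !=set0.
  apply/set0P/eqP => XY0; move: v0; rewrite -rE /overlap XY0 leb_set0; lra.
move: rT; rewrite in_itv/= => /andP[cr rc].
rewrite -rE overlap_fold; case: Yu => [Yu|].
  exists u, (u - r); split=> //; rewrite subKr.
  by rewrite (@overlap_eq0 (r + l)) ?addr0//; right; lra.
rewrite /translate/= opprK => Yu; exists u, (u - r + l); split=> //.
rewrite (_ : u - (u - r + l) = r - l); last by ring.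
rewrite (@overlap_eq0 (r - l - l)); last by left; lra.
by rewrite addr0 subrK addrC.
Qed.

End fold.
End wrap.

(** * Counting modulo a period *)

Section fold_measure.
Context {R : realType}.
Implicit Types (A B C E X Y S : set R) (r x s t l k : R).
Local Notation mu := (@lebesgue_measure R).

Definition fundamental t l : set R := [set` `[t, t + l[].

(** The image of [S] modulo [l], represented in the period that starts at [t];
    the three translates reach every point of the two adjacent periods. *)
Definition fold t l S : set R :=
  fundamental t l `&` (translate l S `|` S `|` translate (- l) S).

Lemma in_fundamental t l x : fundamental t l x <-> t <= x < t + l.
Proof. by rewrite /fundamental/= in_itv. Qed.

Lemma finite_borel_piece t l k S : finite_borel S ->
  finite_borel (fundamental t l `&` translate k S).
Proof.
move=> fS; apply: finite_borelIr; first exact: measurable_itv.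
exact: finite_borel_translate.
Qed.

Lemma finite_borel_fundI t l S : finite_borel S ->
  finite_borel (fundamental t l `&` S).
Proof. by move=> fS; apply: finite_borelIr => //; exact: measurable_itv. Qed.

Lemma finite_borel_fold t l S : finite_borel S -> finite_borel (fold t l S).
Proof.
move=> fS; apply: finite_borel_fundI; apply: finite_borelU.
  by apply: finite_borelU => //; exact: finite_borel_translate.
exact: finite_borel_translate.
Qed.

Lemma leb_pieces t l S : finite_borel S -> 0 < l ->
  leb (fundamental t l `&` translate l S) + leb (fundamental t l `&` S)
  + leb (fundamental t l `&` translate (- l) S)
  = leb ([set` `[t - l, t + l + l[] `&` S).
Proof.
move=> fS l0.
rewrite -(@leb_translate _ (- l) (_ `&` translate l S));
  last exact: finite_borel_piece.
rewrite -(@leb_translate _ l (_ `&` translate (- l) S));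
  last exact: finite_borel_piece.
rewrite -leb_U_disj; first last.
- apply/seteqP; split=> x //=; rewrite /translate/=.
  by move=> [[/in_fundamental/andP[? ?] _] [/in_fundamental/andP[? ?] _]]; lra.
- exact: finite_borel_fundI.
- exact/finite_borel_translate/finite_borel_piece.
rewrite -leb_U_disj; first last.
- apply/seteqP; split=> x //=; rewrite /translate/=.
  by move=> [[[/in_fundamental/andP[? ?] _]|[/in_fundamental/andP[? ?] _]]
    [/in_fundamental/andP[? ?] _]]; lra.
- exact/finite_borel_translate/finite_borel_piece.
- apply: finite_borelU; last exact: finite_borel_fundI.
  exact/finite_borel_translate/finite_borel_piece.
congr leb; apply/seteqP; split=> x;
  rewrite /translate/= !opprK ?addrK ?subrK in_itv/=.
  by case=> [[|]|] [/in_fundamental/andP[? ?] Sx]; split=> //; apply/andP; split;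
    lra.
move=> [/andP[? ?] Sx].
have [xt|tx] := ltP x t.
  by left; left; split=> //; apply/in_fundamental; apply/andP; split; lra.
have [xt|tx'] := ltP x (t + l).
  by left; right; split=> //; apply/in_fundamental; apply/andP; split; lra.
by right; split=> //; apply/in_fundamental; apply/andP; split; lra.
Qed.

Lemma leb_fold_short t l S u : finite_borel S -> 0 < l ->
  S `<=` [set` `[u, u + l[] -> t - l <= u -> u <= t + l ->
  leb (fold t l S) = leb S.
Proof.
move=> fS l0 Su tu ut.
have Sin x : S x -> u <= x < u + l by move/Su; rewrite /= in_itv.
rewrite [RHS](_ : leb S = leb ([set` `[t - l, t + l + l[] `&` S)); last first.
  congr leb; apply/seteqP; split=> [x Sx|x []//].
  by split=> //; rewrite /= in_itv/=; move/Sin: Sx => /andP[? ?]; apply/andP;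
    split; lra.
rewrite -leb_pieces// /fold 2!setIUr leb_U_disj; first last.
- apply/seteqP; split=> x //=; rewrite /translate/=.
  by move=> [[[_ /Sin/andP[? ?]]|[_ /Sin/andP[? ?]]] [_ /Sin/andP[? ?]]]; lra.
- exact: finite_borel_piece.
- by apply: finite_borelU; [exact: finite_borel_piece|exact: finite_borel_fundI].
rewrite leb_U_disj//; first last.
- apply/seteqP; split=> x //=; rewrite /translate/=.
  by move=> [[_ /Sin/andP[? ?]] [_ /Sin/andP[? ?]]]; lra.
- exact: finite_borel_fundI.
- exact: finite_borel_piece.
Qed.

Lemma leb_translateI k k' X Y : finite_borel X -> finite_borel Y ->
  leb (translate k X `&` translate k' Y) = overlap X Y (k' - k).
Proof.
move=> fX fY; rewrite /overlap -[RHS](leb_translate k); last first.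
  by apply: finite_borelI => //; exact: (finite_borel_translate _ fY).1.
by congr leb; apply/funext => x; rewrite /translate/= /setI/=; congr (_ /\ Y _);
  ring.
Qed.

(** Let a, b, c be the parts of [V] in three consecutive periods, brought to the
    middle one. Then |a| + |b| + |c| is at least the measure of the points in at
    least one of them plus that of the points in at least two. The first set contains the
    images of [x + Y] and [X + y], the second one the image of [X], which enters
    with the shifts [y0] and [y0 + l]. *)
Lemma sumset_fold_lower_bound V X Y x0 y0 l x y :
  finite_borel V -> finite_borel X -> finite_borel Y -> 0 < l ->
  X `<=` [set` `[x0, x0 + l[] -> Y `<=` [set` `[y0, y0 + l[] -> X x -> Y y ->
  translate y0 X `<=` V -> translate (y0 + l) X `<=` V ->
  translate y X `<=` V -> translate x Y `<=` V ->
  2 * leb X + leb Y - (overlap X Y (x - y) + overlap X Y (x - y - l)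
    + overlap X Y (x - y + l)) <= leb V.
Proof.
move=> fV fX fY l0 X_itv Y_itv Xx Yy P0V P1V QV SV.
have inX z : X z -> x0 <= z < x0 + l by move=> /X_itv/=; rewrite in_itv.
have inY z : Y z -> y0 <= z < y0 + l by move=> /Y_itv/=; rewrite in_itv.
have /andP[x0x xx0] := inX _ Xx; have /andP[y0y yy0] := inY _ Yy.
set t := x + y0; have tE : t = x + y0 by []; set T := fundamental t l.
set P := translate y0 X; set Q := translate y X; set S := translate x Y.
have fP : finite_borel P by exact: finite_borel_translate.
have fQ : finite_borel Q by exact: finite_borel_translate.
have fS : finite_borel S by exact: finite_borel_translate.
set a := T `&` translate l V; set b := T `&` V; set c := T `&` translate (- l) V.
have fa : finite_borel a by exact: finite_borel_piece.
have fb : finite_borel b by exact: finite_borel_fundI.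
have fc : finite_borel c by exact: finite_borel_piece.
have leabc : leb a + leb b + leb c <= leb V.
  rewrite leb_pieces//; apply: le_leb => //.
  by apply: finite_borelIr => //; exact: measurable_itv.
have fab := finite_borelU fa fb.
have fI2 := finite_borelI fab fc.1; have fI1 := finite_borelI fa fb.1.
have E1 := leb_UI fa fb; have E2 := leb_UI fab fc.
have E3 := le_leb_U fI2 fI1.
(* A point of X + y0 and its image under the shift by l both lie in [V]. *)
have leP : leb X <= leb (((a `|` b) `&` c) `|` (a `&` b)).
  rewrite -(leb_translate y0 fX) -(@leb_fold_short t l P (x0 + y0))//; first last.
  - by rewrite /t; lra.
  - by rewrite /t; lra.
  - by move=> z /inX/andP[? ?]; rewrite /= in_itv/=; apply/andP; split; lra.
  apply: le_leb; [exact: finite_borel_fold|exact: finite_borelU|].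
  move=> z [Tz]; have /in_fundamental/andP[? ?] := Tz; case=> [[Pz|Pz]|Pz].
  - right; split; split=> //; first exact: P0V.
    by apply: P1V; move: Pz; rewrite /P /translate/=; congr X; ring.
  - left; split; first by right; split=> //; exact: P0V.
    split=> //; apply: P1V; move: Pz; rewrite /P /translate/=; congr X; ring.
  - by move: Pz => /inX/andP[? ?]; lra.
have leQ : leb (fold t l Q `|` S) <= leb (a `|` b `|` c).
  apply: le_leb; [by apply: finite_borelU => //;
    exact: finite_borel_fold|exact: finite_borelU|].
  move=> z [[Tz [[Qz|Qz]|Qz]]|Sz].
  - by left; left; split=> //; exact: QV.
  - by left; right; split=> //; exact: QV.
  - by right; split=> //; exact: QV.
  - left; right; split; last exact: SV.
    by apply/in_fundamental; move: Sz => /inY/andP[? ?]; apply/andP; split;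
      rewrite /t; lra.
have foldQ : leb (fold t l Q) = leb X.
  rewrite -(leb_translate y fX); apply: (@leb_fold_short t l Q (x0 + y)) => //.
  - by move=> z /inX/andP[? ?]; rewrite /= in_itv/=; apply/andP; split; lra.
  - by rewrite /t; lra.
  - by rewrite /t; lra.
have E4 := leb_UI (finite_borel_fold t l fQ) fS.
have fQk k : finite_borel (translate k Q `&` S).
  by apply: finite_borelI; [exact: finite_borel_translate|exact: fS.1].
have fQ0 : finite_borel (Q `&` S) by apply: finite_borelI => //; exact: fS.1.
have leI : leb (fold t l Q `&` S) <= overlap X Y (x - y) + overlap X Y (x - y - l)
    + overlap X Y (x - y + l).
  have -> : overlap X Y (x - y) = leb (Q `&` S) by rewrite leb_translateI.
  have -> : overlap X Y (x - y - l) = leb (translate l Q `&` S).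
    rewrite translateD leb_translateI//; congr overlap; ring.
  have -> : overlap X Y (x - y + l) = leb (translate (- l) Q `&` S).
    rewrite translateD leb_translateI//; congr overlap; ring.
  apply: (@le_trans _ _ (leb
    ((Q `&` S) `|` (translate l Q `&` S) `|` (translate (- l) Q `&` S)))).
    apply: le_leb.
    - by apply: finite_borelI; [exact: finite_borel_fold|exact: fS.1].
    - by do 2 apply: finite_borelU => //.
    - by move=> z [[_ [[?|?]|?]] ?]; [left; right|left; left|right].
  apply: (le_trans (le_leb_U _ _)) => //; first exact: finite_borelU.
  by rewrite lerD2r le_leb_U.
rewrite (leb_translate x fY) foldQ in E4.
lra.
Qed.

End fold_measure.

(** * Sumsets of almost minimal measure, trimmed sets *)

Section stability.
Context {R : realType}.
Implicit Types (A B C E X Y S W : set R) (r x s t l k : R).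
Local Notation mu := (@lebesgue_measure R).

(** The previous bound for the union of [W] with the four translates, each of
    which sticks out of [W] by at most [s]. *)
Lemma leb_sumset_lower W X Y s x0 y0 y1 :
  finite_borel W -> finite_borel X -> finite_borel Y ->
  0 < leb X -> 0 < leb Y -> y0 < y1 ->
  X `<=` [set` `[x0, x0 + (y1 - y0)[] -> Y `<=` [set` `[y0, y1[] ->
  (forall x, X x -> leb (translate x Y `\` W) <= s) ->
  (forall y, [\/ Y y, y = y0 | y = y1] -> leb (translate y X `\` W) <= s) ->
  2 * leb X + leb Y - leb X * leb Y / (y1 - y0) <= leb W + 4 * s.
Proof.
move=> fW fX fY X0 Y0 y01 Xi Yi XW YW.
have Yi' : Y `<=` [set` `[y0, y0 + (y1 - y0)[] by rewrite addrC subrK.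
have l0 : 0 < y1 - y0 by rewrite subr_gt0.
(* The quotient |X| |Y| / l is replaced by the overlap of [x + Y] and [X + y]. *)
have [x [y [Xx Yy <-]]] := exists_small_overlap fX fY Xi Yi' X0 Y0 l0.
set P0 := translate y0 X; set P1 := translate y1 X.
set Q := translate y X; set S := translate x Y.
have fP0 : finite_borel P0 by exact: finite_borel_translate.
have fP1 : finite_borel P1 by exact: finite_borel_translate.
have fQ : finite_borel Q by exact: finite_borel_translate.
have fS : finite_borel S by exact: finite_borel_translate.
have grow V Z : finite_borel V -> finite_borel Z -> W `<=` V -> leb (Z `\` W) <= s ->
    leb (V `|` Z) <= leb V + s.
  move=> fV fZ WV ZW;
    have fZV : finite_borel (Z `\` V) by exact: finite_borelD fV.1.
  have fZW : finite_borel (Z `\` W) by exact: finite_borelD fW.1.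
  rewrite -(setDUK (@subsetUl _ V Z)).
  apply: le_trans (le_leb_U _ _) _ => //; first by rewrite setDUl setDv set0U.
  rewrite setDUl setDv set0U lerD2l; apply: le_trans ZW; apply: le_leb => //.
  by move=> z [Zz nVz]; split=> // /WV.
have fV1 := finite_borelU fW fP0; have fV2 := finite_borelU fV1 fP1.
have fV3 := finite_borelU fV2 fQ; have fV4 := finite_borelU fV3 fS.
have g1 := grow W P0 fW fP0 (fun z => id) (YW _ (Or32 _ _ erefl)).
have g2 := grow _ P1 fV1 fP1 (fun z h => or_introl h) (YW _ (Or33 _ _ erefl)).
have g3 := grow _ Q fV2 fQ (fun z h =>
  or_introl (or_introl h)) (YW _ (Or31 _ _ Yy)).
have g4 := grow _ S fV3 fS (fun z h =>
  or_introl (or_introl (or_introl h))) (XW _ Xx).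
have := sumset_fold_lower_bound fV4 fX fY l0 Xi Yi' Xx Yy.
have sub : [/\ P0 `<=` W `|` P0 `|` P1 `|` Q `|` S, P1 `<=` W `|` P0 `|` P1 `|` Q `|` S,
    Q `<=` W `|` P0 `|` P1 `|` Q `|` S & S `<=` W `|` P0 `|` P1 `|` Q `|` S].
  by split=> z Zz; [left; left; left; right|left; left; right|left; right|right].
case: sub => s1 s2 s3 s4 /(_ s1); rewrite [y0 + _]addrC subrK => /(_ s2 s3 s4); lra.
Qed.

(** The lower bound for |W| gives |X| (l - |Y|) <= (k + 4 s) l with l = y1 - y0;
    the size of [X] makes l <= 2 |Y|. The interval is the union of the hulls of
    x0 + Y and x1 + Y, which meet because the hull of [X] is the shorter one. *)
Lemma near_interval_of_hulls W X Y s k x0 x1 y0 y1 :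
  finite_borel W -> finite_borel X -> finite_borel Y ->
  0 < leb Y -> 0 < s -> 0 <= k -> 2 * (k + 4 * s) <= leb X ->
  x1 - x0 <= y1 - y0 ->
  X `<=` [set` `[x0, x1[] -> Y `<=` [set` `[y0, y1[] ->
  (forall x, [\/ X x, x = x0 | x = x1] -> leb (translate x Y `\` W) <= s) ->
  (forall y, [\/ Y y, y = y0 | y = y1] -> leb (translate y X `\` W) <= s) ->
  leb W <= leb X + leb Y + k ->
  exists I, [/\ finite_borel I, bounded_interval I &
    leb X * leb (W `+` I) <= 8 * (k + 4 * s) * leb Y + (4 * s + k) * leb X].
Proof.
move=> fW fX fY Y0 s0 k0 Xk xy Xi Yi XW YW WXY.
have X0 : 0 < leb X by apply: lt_le_trans Xk; lra.
have len (Z : set R) (z0 z1 : R) : finite_borel Z -> 0 < leb Z -> Z `<=`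
  [set` `[z0, z1[] ->
    z0 < z1 /\ leb Z <= z1 - z0.
  move=> fZ Z0 Zi; have z01 : z0 < z1.
    have [u Zu] : Z !=set0 by apply/set0P/eqP => Z_eq0; move: Z0;
      rewrite Z_eq0 leb_set0 ltxx.
    by have := Zi _ Zu; rewrite /= in_itv/= => /andP[? ?]; lra.
  split=> //; rewrite -(@leb_itv _ true true z0 z1 (ltW z01)).
  by apply: le_leb => //; exact: finite_borel_itv.
have [x01 lX] := len X x0 x1 fX X0 Xi; have [y01 lY] := len Y y0 y1 fY Y0 Yi.
set l := y1 - y0; have lE : l = y1 - y0 by []. have l0 : 0 < l by rewrite subr_gt0.
have Xi' : X `<=` [set` `[x0, x0 + (y1 - y0)[].
  by move=> z /Xi; rewrite /= !in_itv/= => /andP[? ?]; apply/andP; split; lra.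
have low := leb_sumset_lower fW fX fY X0 Y0 y01 Xi' Yi
  (fun x Xx => XW x (Or31 _ _ Xx)) YW.
have gap : leb X * (l - leb Y) <= (k + 4 * s) * l.
  have : leb X - leb X * leb Y / l <= k + 4 * s by rewrite /l; lra.
  rewrite -(ler_pM2r l0) mulrBl divfK ?gt_eqF//; lra.
have l2 : l <= 2 * leb Y.
  have : 2 * (k + 4 * s) * (l - leb Y) <= leb X * (l - leb Y).
    by apply: ler_wpM2r => //; lra.
  move=> H; have : (k + 4 * s) * (2 * (l - leb Y)) <= (k + 4 * s) * l by lra.
  by rewrite ler_pM2l; lra.
have gap2 : leb X * (l - leb Y) <= (k + 4 * s) * (2 * leb Y).
  by apply: (le_trans gap); rewrite ler_pM2l//; lra.
set I : set R := [set` `[x0 + y0, x1 + y1[].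
have fI : finite_borel I by exact: finite_borel_itv.
have leI : leb I = (x1 - x0) + l by rewrite leb_itv; lra.
have part x : leb (translate x Y `\` W) <= s ->
    leb ([set` `[x + y0, x + y1[] `\` W) <= l - leb Y + s.
  move=> xW; have fT : finite_borel (translate x Y) by exact: finite_borel_translate.
  have fJ : finite_borel ([set` `[x + y0, x + y1[] : set R) by exact: finite_borel_itv.
  have TJ : translate x Y `<=` [set` `[x + y0, x + y1[].
    by move=> z /Yi; rewrite /= !in_itv/= => /andP[? ?]; apply/andP; split; lra.
  have -> : l - leb Y = leb ([set` `[x + y0, x + y1[] `\` translate x Y).
    have := leb_DI fJ fT.1; rewrite leb_itv; last by lra.
    rewrite (setIidr TJ) leb_translate//; lra.
  apply: le_trans (lerD (lexx _) xW); apply: le_trans (le_leb_U _ _).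
  - apply: le_leb; first by exact: finite_borelD fW.1.
      by apply: finite_borelU;
        [exact: finite_borelD fT.1|exact: finite_borelD fW.1].
    by move=> z [Jz nWz]; have [Tz|nTz] := pselect (translate x Y z); [right|left].
  - exact: finite_borelD fT.1.
  - exact: finite_borelD fW.1.
have IW : leb (I `\` W) <= 2 * (l - leb Y) + 2 * s.
  have h0 := part _ (XW _ (Or32 _ _ erefl));
    have h1 := part _ (XW _ (Or33 _ _ erefl)).
  have f0 : finite_borel ([set` `[x0 + y0, x0 + y1[] `\` W).
    by apply: finite_borelD fW.1; exact: finite_borel_itv.
  have f1 : finite_borel ([set` `[x1 + y0, x1 + y1[] `\` W).
    by apply: finite_borelD fW.1; exact: finite_borel_itv.
  have := le_leb_U f0 f1; rewrite -setDUl.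
  suff : leb (I `\` W) <= leb (([set` `[x0 + y0, x0 + y1[] `|`
    [set` `[x1 + y0, x1 + y1[]) `\` W) by lra.
  apply: le_leb; first exact: finite_borelD fW.1.
    by rewrite setDUl; exact: finite_borelU.
  move=> z [Iz nWz]; split=> //; move: Iz; rewrite /I /= !in_itv/= => /andP[z0 z1].
  have [zz|zz] := ltP z (x0 + y1); first by left; rewrite z0.
  by right; rewrite z1 andbT; lra.
exists I; split=> //.
  split; first exact: interval_is_interval.
  exists (`|x0 + y0| + `|x1 + y1|); split; first exact: num_real.
  move=> M ltM z; rewrite /I /= in_itv/= => /andP[z0 z1].
  rewrite ler_norml; have := ler_norm (x1 + y1); have := ler_norm (- (x0 + y0)).
  have := normr_ge0 (x0 + y0); have := normr_ge0 (x1 + y1).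
  by rewrite normrN => *; apply/andP; split; lra.
have -> : leb (W `+` I) = leb (W `\` I) + leb (I `\` W).
  rewrite /setY leb_U_disj//.
  - by exact: finite_borelD fI.1.
  - by exact: finite_borelD fW.1.
  - by apply/seteqP; split=> z //= [[? ?] []].
have e1 := leb_DI fW fI.1; have e2 := leb_DI fI fW.1.
rewrite [I `&` W]setIC in e2.
have : leb (W `\` I) + leb (I `\` W) <= 4 * (l - leb Y) + (4 * s + k) by lra.
rewrite -(ler_pM2l X0); lra.
Qed.

End stability.

(** * Sumsets of almost minimal measure, general sets *)

Section trimming.
Context {R : realType}.
Implicit Types (A B C E X Y S W : set R) (r x s t l k : R).
Local Notation mu := (@lebesgue_measure R).

Lemma trim_ends S s : finite_borel S -> 0 < s -> 2 * s < leb S ->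
  exists x0 x1, [/\ S x0, S x1 & leb S - 2 * s <= leb (S `&` [set` `[x0, x1[])].
Proof.
move=> fS s0 sS.
have [|r0 r0E] := @quantile _ S s fS; first by apply/andP; split;
  rewrite ?leb_ge0 //; lra.
have [|r1 r1E] := @quantile _ S (leb S - s) fS; first by apply/andP; split;
  rewrite ?leb_ge0 //; lra.
have r1E' : leb (above S r1) = s by have := leb_below_above r1 fS; lra.
have nonempty A : leb A = s -> A !=set0.
  by move=> As; apply/set0P/eqP => A0; move: s0; rewrite -As A0 leb_set0 ltxx.
have [x0 [Sx0 /=]] := nonempty _ r0E; rewrite in_itv/= => xr0.
have [x1 [Sx1 /=]] := nonempty _ r1E'; rewrite in_itv/= andbT => xr1.
exists x0, x1; split=> //.
have /andP[le0 _] := leb_below_lipschitz fS (ltW xr0).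
have /andP[le1 _] := leb_below_lipschitz fS xr1.
have fM : finite_borel (S `&` [set` `[x0, x1[]) by exact: finite_borelI.
have : leb (below S x1) <= leb (below S x0) + leb (S `&` [set` `[x0, x1[]).
  apply: le_trans (le_leb_U _ _) => //; last exact: finite_borel_below.
  apply: le_leb; first exact: finite_borel_below.
    by apply: finite_borelU => //; exact: finite_borel_below.
  move=> x [Sx /=]; rewrite in_itv/= => xx1.
  have [xx0|x0x] := ltP x x0; first by left; split=> //=; rewrite in_itv.
  by right; split=> //=; rewrite in_itv/= x0x.
lra.
Qed.

Lemma convol_mirror0 X Y x : convol X (mirror 0 Y) x = mu (X `&` translate x Y).
Proof.
by congr mu; congr (_ `&` _); apply/funext => u;
  rewrite /mirror /translate/= sub0r opprB.
Qed.

(** Markov's inequality. *)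
Lemma trim_bad W X Y s : finite_borel W -> finite_borel X -> finite_borel Y ->
  0 < s -> (\int[mu]_(x in X) mu (~` W `&` translate (x : R) Y) <= (s ^+ 2)%:E)%E ->
  exists X', [/\ finite_borel X', X' `<=` X, leb X - s <= leb X' &
    forall x, X' x -> leb (translate x Y `\` W) <= s].
Proof.
move=> fW fX fY s0 Is.
set phi := convol (~` W) (mirror 0 Y).
have phiE x : phi x = (leb (translate x Y `\` W))%:E.
  rewrite /phi convol_mirror0 lebE; first by rewrite setDE setIC.
  by apply: finite_borelD fW.1; exact: finite_borel_translate.
have mphi : measurable_fun setT phi.
  apply: measurable_convol; first exact: measurableC fW.1.
  exact: (finite_borel_mirror 0 fY).1.
have mbad : measurable (phi @^-1` [set` `]s%:E, +oo[%E]).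
  by rewrite -[X in measurable X]setTI; apply: mphi => //; exact: emeasurable_itv.
set bad := _ @^-1` _ in mbad.
have badP x : bad x <-> s < leb (translate x Y `\` W).
  by rewrite /bad /= in_itv/= andbT phiE lte_fin.
exists (X `\` bad); split.
- exact: finite_borelD.
- exact: subDsetl.
- have fb : finite_borel (X `&` bad) by exact: finite_borelI.
  have := leb_DI fX mbad.
  suff : leb (X `&` bad) <= s by lra.
  suff : s * leb (X `&` bad) <= s * s by rewrite ler_pM2l.
  rewrite -lee_fin -expr2; apply: le_trans Is.
  apply: (@le_trans _ _ (\int[mu]_(x in X `&` bad) phi x)%E).
    rewrite EFinM lebE// -integral_cst; last exact: fb.1.
    apply: ge0_le_integral => //.
    + exact: fb.1.
    + by move=> x _; rewrite lee_fin ltW.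
    + exact: measurable_funS mphi.
    + by move=> x [_ /badP/ltW]; rewrite phiE lee_fin.
  have -> : (\int[mu]_(x in X) mu (~` W `&` translate (x : R) Y)
     = \int[mu]_(x in X) phi x)%E.
    by apply: eq_integral => x _; rewrite /phi convol_mirror0.
  apply: ge0_subset_integral => //.
  + exact: fb.1.
  + exact: fX.1.
  + exact: measurable_funS mphi.
- by move=> x [_ nb]; rewrite leNgt; apply/negP => /badP.
Qed.

Lemma integral_sumset_sym W X Y : measurable W -> measurable X -> measurable Y ->
  (\int[mu]_(x in X) mu (W `&` translate (x : R) Y)
   = \int[mu]_(y in Y) mu (W `&` translate (y : R) X))%E.
Proof.
move=> mW mX mY; rewrite -!integral_convol//.
by apply: eq_integral => x _; exact: convolC.
Qed.

(** Trimming costs 3 s for each of [X] and [Y], whence k = 8 s in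
    [near_interval_of_hulls]; the hypothesis 30 s <= n leaves the trimmed sets at
    least n / 2 and 24 s, and 216 = 2 (8 * 12 + 12). The roles of [X] and [Y] are
    interchangeable, so the longer hull may belong to either. *)
Lemma sumset_stability W X Y s n N : finite_borel W -> finite_borel X ->
  finite_borel Y -> 0 < s -> 30 * s <= n ->
  n <= leb X <= N -> n <= leb Y <= N ->
  (\int[mu]_(x in X) mu (~` W `&` translate (x : R) Y) <= (s ^+ 2)%:E)%E ->
  leb W <= leb X + leb Y + 2 * s ->
  exists I, [/\ finite_borel I, bounded_interval I &
    n * leb (W `+` I) <= 216 * s * N].
Proof.
move=> fW fX fY s0 sn /andP[nX XN] /andP[nY YN] Is WXY.
have [X1 [fX1 X1X leX1 goodX]] := trim_bad fW fX fY s0 Is.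
have [Y1 [fY1 Y1Y leY1 goodY]] : exists Y', [/\ finite_borel Y', Y' `<=` Y,
    leb Y - s <= leb Y' & forall y, Y' y -> leb (translate y X `\` W) <= s].
  apply: trim_bad => //; rewrite integral_sumset_sym//.
  - exact: measurableC fW.1.
  - exact: fY.1.
  - exact: fX.1.
have [|x0 [x1 [X1x0 X1x1 leX2]]] := trim_ends fX1 s0; first by lra.
have [|y0 [y1 [Y1y0 Y1y1 leY2]]] := trim_ends fY1 s0; first by lra.
set X2 := X1 `&` _ in leX2; set Y2 := Y1 `&` _ in leY2.
have fX2 : finite_borel X2 by exact: finite_borelI.
have fY2 : finite_borel Y2 by exact: finite_borelI.
have leX2' : leb X2 <= N by apply: le_trans XN; apply: le_leb => // z [/X1X].
have leY2' : leb Y2 <= N by apply: le_trans YN; apply: le_leb => // z [/Y1Y].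
have mono x Z Z' : finite_borel Z -> finite_borel Z' -> Z' `<=` Z ->
    leb (translate x Z `\` W) <= s -> leb (translate x Z' `\` W) <= s.
  move=> fZ fZ' ZZ; apply: le_trans; apply: le_leb.
  - by apply: finite_borelD fW.1; exact: finite_borel_translate.
  - by apply: finite_borelD fW.1; exact: finite_borel_translate.
  - by move=> z [/ZZ ? ?].
have gX x : [\/ X2 x, x = x0 | x = x1] -> leb (translate x Y2 `\` W) <= s.
  move=> h; apply: (mono x Y) => //; first by move=> z [/Y1Y].
  by apply: goodX; case: h => [[]||] => [//|->|->].
have gY y : [\/ Y2 y, y = y0 | y = y1] -> leb (translate y X2 `\` W) <= s.
  move=> h; apply: (mono y X) => //; first by move=> z [/X1X].
  by apply: goodY; case: h => [[]||] => [//|->|->].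
have finish Z Z' I : n - 3 * s <= leb Z <= N -> 0 <= leb Z' <= N ->
    leb Z * leb (W `+` I) <= 8 * (8 * s + 4 * s) * leb Z' + (4 * s + 8 * s) * leb Z ->
    n * leb (W `+` I) <= 216 * s * N.
  move=> /andP[nZ ZN] /andP[_ Z'N] H.
  have h1 : n * leb (W `+` I) <= 2 * (leb Z * leb (W `+` I)).
    by rewrite mulrA ler_wpM2r ?leb_ge0//; lra.
  have h2 : s * leb Z' <= s * N by rewrite ler_pM2l.
  have h3 : s * leb Z <= s * N by rewrite ler_pM2l.
  have h4 : 0 <= s * N by rewrite mulr_ge0 ?(ltW s0)//; lra.
  lra.
have [xy|yx] := leP (x1 - x0) (y1 - y0).
  have [||||||I [mI bI HI]] := @near_interval_of_hulls _ W X2 Y2 s (8 * s) x0 x1 y0 y1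
    fW fX2 fY2 _ s0 _ _ xy _ _ gX gY; try lra.
  - by move=> z [].
  - by move=> z [].
  exists I; split=> //; apply: finish HI; apply/andP; split; rewrite ?leb_ge0 //;
    lra.
have [||||||I [mI bI HI]] := @near_interval_of_hulls _ W Y2 X2 s (8 * s) y0 y1 x0 x1
  fW fY2 fX2 _ s0 _ _ (ltW yx) _ _ gY gX; try lra.
- by move=> z [].
- by move=> z [].
exists I; split=> //; apply: finish HI; apply/andP; split; rewrite ?leb_ge0 //; lra.
Qed.

End trimming.

(** * The value of the pairing for the rearranged sets *)

Section intervals.
Context {R : realType}.
Implicit Types (A B C E X Y S W : set R) (r x s t l k : R).
Local Notation mu := (@lebesgue_measure R).

Lemma ge0_integral_translate r E (f : R -> \bar R) : measurable E ->
  measurable_fun setT f -> (forall x, 0 <= f x)%E ->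
  (\int[mu]_(x in translate r E) f ((x : R) - r)%R = \int[mu]_(x in E) f x)%E.
Proof.
move=> mE mf f0.
have mg : measurable_fun [set: measurableTypeR R]
    (fun x : measurableTypeR R => (x : R) - r : measurableTypeR R).
  exact: (@measurable_funB _ R R setT id (cst r)).
transitivity (\int[pushforward mu
    (fun x : measurableTypeR R =>
      ((x : R) - r)%R : measurableTypeR R)]_(x in E) f x)%E.
  apply/esym; apply: (ge0_integral_pushforward mg) => //.
  exact: measurable_funS mf.
apply: eq_measure_integral => S mS _; exact: mu_translate.
Qed.

Lemma le_convol_itv (X X' Y Y' : set R) x :
  (forall u, X u -> Y (x - u) -> X' u /\ Y' (x - u)) ->
  (convol X Y x <= convol X' Y' x)%E.
Proof.
by move=> H; apply: le_outer_measure => u [Xu Yu]; have [] := H u Xu Yu.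
Qed.

(** The mass of the convolution outside ]-c/2, c/2[ is at most t^2: there the
    convolution only sees the right ends, respectively the left ends, of length t
    of both intervals. Translating the left tail by c glues the two tails into the
    convolution of one pair of intervals of length t, of total mass t^2. *)
Lemma convol_star_lower_bound (a b c t : R) : 0 < t -> t <= a -> t <= b ->
  0 < c -> c = a + b - 2 * t ->
  ((a * b - t ^+ 2)%:E <=
   \int[mu]_(x in [set` `](- (c / 2))%R, (c / 2)%R[])
     convol `](- (a / 2))%R, (a / 2)%R[ `](- (b / 2))%R, (b / 2)%R[ x)%E.
Proof.
move=> t0 ta tb c0 cE.
set A := [set` `](- (a / 2)), (a / 2)[]; set B := [set` `](- (b / 2)), (b / 2)[].
have fA : finite_borel A by exact: finite_borel_itv.
have fB : finite_borel B by exact: finite_borel_itv.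
set A1 : set R := [set` `](a / 2 - t), (a / 2)[].
set B1 : set R := [set` `](b / 2 - t), (b / 2)[].
have fA1 : finite_borel A1 by exact: finite_borel_itv.
have fB1 : finite_borel B1 by exact: finite_borel_itv.
have mAB : measurable_fun setT (convol A B) := measurable_convol fA.1 fB.1.
have mAB1 : measurable_fun setT (convol A1 B1) := measurable_convol fA1.1 fB1.1.
have right_tail x : c / 2 <= x -> (convol A B x <= convol A1 B1 x)%E.
  move=> cx; apply: le_convol_itv => u; rewrite /A /B /A1 /B1 /= !in_itv/=.
  by move=> /andP[? ?] /andP[? ?]; split; apply/andP; split; lra.
have left_tail x : x <= - (c / 2) -> (convol A B x <= convol A1 B1 (x + c))%E.
  move=> cx; rewrite /convol.
  rewrite -[X in (X <= _)%E](@mu_translate _ (a - t)); last first.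
    by apply: measurableI; [exact: fA.1|apply: measurable_mirror; exact: fB.1].
  apply: le_outer_measure => u;
    rewrite /translate /mirror /A /B /A1 /B1 /= !in_itv/=.
  by move=> [/andP[? ?] /andP[? ?]]; split; apply/andP; split; lra.
have total := integral_convol_total fA fB.
have total1 := integral_convol_total fA1 fB1.
have lA : leb A = a by rewrite leb_itv; lra.
have lB : leb B = b by rewrite leb_itv; lra.
have lA1 : leb A1 = t by rewrite leb_itv; lra.
have lB1 : leb B1 = t by rewrite leb_itv; lra.
rewrite lA lB in total; rewrite lA1 lB1 in total1.
set C := [set` `](- (c / 2)), (c / 2)[].
set L : set R := [set` `]-oo, (- (c / 2))]];
  set U : set R := [set` `[(c / 2), +oo[].
set L1 : set R := [set` `]-oo, (c / 2)[].
have mU : measurable U by exact: measurable_itv.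
have mL : measurable L by exact: measurable_itv.
have mC : measurable C by exact: measurable_itv.
have mL1 : measurable L1 by exact: measurable_itv.
have split_total : (\int[mu]_x convol A B x = \int[mu]_(x in C) convol A B x
    + (\int[mu]_(x in L) convol A B x + \int[mu]_(x in U) convol A B x))%E.
  rewrite -ge0_integral_setU//; first last.
  - apply/disj_setPS => x [Lx Ux]; move: Lx Ux; rewrite /L /U /= !in_itv/= andbT;
    lra.
  - exact: measurable_funS mAB.
  rewrite -ge0_integral_setU//; first last.
  - apply/disj_setPS => x [Cx LUx]; move: Cx LUx;
    rewrite /C /L /U /= !in_itv/= andbT => /andP[? ?] []; lra.
  - exact: measurable_funS mAB.
  - exact: measurableU.
  congr integral; apply/seteqP; split=> x //= _;
    rewrite /C /L /U /= !in_itv/= andbT.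
  have [xl|lx] := leP x (- (c / 2)); first by right; left.
  have [ux|xu] := leP (c / 2) x; first by right; right.
  by left.
have intL : (\int[mu]_(x in L) convol A B x <= \int[mu]_(x in L1) convol A1 B1 x)%E.
  apply: (@le_trans _ _ (\int[mu]_(x in L) convol A1 B1 (x + c)%R)%E).
    apply: ge0_le_integral => //.
    - exact: measurable_funS mAB.
    - by apply: measurable_funS measurableT _ _ => //;
      apply: measurableT_comp => //; exact: measurable_funD.
  rewrite /L1 integral_itv_bndo_bndc; last exact: measurable_funS mAB1.
  rewrite -(@ge0_integral_translate (- c) _ _ (measurable_itv _) mAB1);
    last exact: convol_ge0.
  rewrite (_ : translate _ _ = L); last first.
    by apply/funext => x; rewrite /translate /L /= !in_itv/=; apply/propext;
      split; lra.
  by under [leRHS]eq_integral do rewrite opprK.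
have intU : (\int[mu]_(x in U) convol A B x <= \int[mu]_(x in U) convol A1 B1 x)%E.
  apply: ge0_le_integral => //.
  - exact: measurable_funS mAB.
  - exact: measurable_funS mAB1.
  - by move=> x; rewrite /U /= in_itv/= andbT; exact: right_tail.
have split1 : (\int[mu]_(x in L1) convol A1 B1 x + \int[mu]_(x in U) convol A1 B1 x
    = \int[mu]_x convol A1 B1 x)%E.
  rewrite -ge0_integral_setU//.
  - by rewrite /L1 /U -setCitvr setUC setUv.
  - exact: measurable_funS mAB1.
  - by apply/disj_setPS; rewrite /L1 /U -setCitvr setICl.
have tails : (\int[mu]_(x in L) convol A B x + \int[mu]_(x in U) convol A B x
    <= (t ^+ 2)%:E)%E.
  by rewrite expr2 -total1 -split1 leeD.
have : ((a * b)%:E <= \int[mu]_(x in C) convol A B x + (t ^+ 2)%:E)%E.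
  by rewrite -total split_total; exact: leeD2l.
by rewrite EFinB leeBlDr.
Qed.

End intervals.

(** * Borel cores of Lebesgue measurable sets *)

Section reduction.
Context {R : realType}.
Implicit Types (A B C E X Y S W N : set R) (r x s t l k : R).
Local Notation mu := (@lebesgue_measure R).
Local Notation cmu := (@completed_lebesgue_measure R).

(** For a Lebesgue measurable [A] the set of pairs (x, u) with x - u in [A] need
    not be measurable for the product of the completed sigma-algebras, so Tonelli
    is applied to a Borel set that differs from [A] by a null set. *)
Definition borel_core A0 A := [/\ measurable A0, A0 `<=` A &
  exists N, [/\ measurable N, mu N = 0%E & A `<=` A0 `|` N]].

Lemma borel_core_refl A : measurable A -> borel_core A A.
Proof.
move=> mA; split=> //; exists set0; split; [exact: measurable0|exact: measure0|].
by rewrite setU0.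
Qed.

Lemma lebesgue_measurable_core A : lebesgue_measurable A ->
  exists A0, borel_core A0 A.
Proof.
rewrite /lebesgue_measurable -completed_caratheodory_measurable.
rewrite g_sigma_completed_algebra_genE => -[A0 mA0 [N [N' [mN' N'0 NN']]]] <-.
exists A0; split=> //.
by exists N'; split=> //; exact: setUS.
Qed.

Lemma borel_core_mirror r A0 A : borel_core A0 A ->
  borel_core (mirror r A0) (mirror r A).
Proof.
move=> [mA0 A0A [N [mN N0 AN]]]; split; first exact: measurable_mirror.
  by move=> x; exact: A0A.
exists (mirror r N); split; first exact: measurable_mirror.
  by rewrite -N0; exact: mu_mirror.
by move=> x; exact: AN.
Qed.

Lemma borel_coreI A0 A B0 B : borel_core A0 A -> borel_core B0 B ->
  borel_core (A0 `&` B0) (A `&` B).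
Proof.
move=> [mA0 A0A [N [mN N0 AN]]] [mB0 B0B [M [mM M0 BM]]].
split; [exact: measurableI|exact: setISS|].
exists (N `|` M); split; first exact: measurableU.
  exact: null_set_setU.
by move=> x [/AN [?|?] /BM [?|?]]; [left|right; right|right; left|right; left].
Qed.

Lemma borel_core_mu A0 A : borel_core A0 A -> cmu A = mu A0.
Proof.
move=> [mA0 A0A [N [mN N0 AN]]]; apply/eqP; rewrite eq_le; apply/andP; split.
  rewrite -(@measureU0 _ _ R mu _ _ mA0 mN N0); exact: le_outer_measure.
exact: le_outer_measure.
Qed.

Lemma borel_core_leb A0 A : borel_core A0 A -> leb A = leb A0.
Proof. by move=> cA; rewrite /leb (borel_core_mu cA). Qed.

Lemma borel_core_negligible A0 A : borel_core A0 A ->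
  cmu.-negligible (A `\` A0).
Proof.
move=> [mA0 A0A [N [mN N0 AN]]]; exists N; split=> //;
  first exact: sub_caratheodory.
by move=> x [/AN []].
Qed.

Lemma borel_core_measurable A0 A : borel_core A0 A -> lebesgue_measurable A.
Proof.
move=> cA; have [mA0 A0A _] := cA; rewrite -(setDUK A0A).
apply: measurableU; first exact: sub_caratheodory.
exact/negligible_sub_caratheodory/borel_core_negligible.
Qed.

Lemma finite_positive_core A : finite_positive_measure A ->
  exists A0, [/\ borel_core A0 A, finite_borel A0 & 0 < leb A0].
Proof.
move=> [/lebesgue_measurable_core [A0 cA] /andP[A_gt0 A_fin]].
have fA0 : finite_borel A0 by split; [case: cA|rewrite -(borel_core_mu cA)].
exists A0; split=> //; rewrite -lte_fin lebE// -(borel_core_mu cA)//.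
Qed.

Lemma convolution_core A0 A B0 B x : borel_core A0 A -> borel_core B0 B ->
  finite_borel A0 -> finite_borel B0 ->
  convolution \1_A \1_B x = fine (convol A0 B0 x).
Proof.
move=> cA cB fA0 fB0; rewrite convolC; [|exact: fA0.1|exact: fB0.1].
have cI := borel_coreI cB (borel_core_mirror x cA).
rewrite /convolution /Rintegral /convol -(borel_core_mu cI); congr fine.
under eq_integral => y _.
  rewrite (_ : \1_A (x - y) * \1_B y = \1_(B `&` mirror x A) y); last first.
    by rewrite indicI /= mulrC.
  over.
by rewrite integral_indic ?setIT//; exact: borel_core_measurable cI.
Qed.

End reduction.

(** * The pairing as an integral over Borel cores *)

Section pairing.
Context {R : realType}.
Implicit Types (A B C E X Y S W N : set R) (r x s t l k : R).
Local Notation mu := (@lebesgue_measure R).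
Local Notation cmu := (@completed_lebesgue_measure R).
Local Notation cara := (caratheodory_type (@wlength R idfun)^*%mu).

Lemma measurable_fun_cara (D : set R) (f : R -> \bar R) :
  measurable_fun setT f -> measurable_fun (D : set cara) (f : cara -> \bar R).
Proof.
move=> mf mD S mS; apply: measurableI => //; apply: sub_caratheodory.
by rewrite -[X in _ X]setTI; exact: mf.
Qed.

(** The Lebesgue measure on Borel sets is the image of the completed measure under
    the identity map. *)
Lemma ge0_integral_completed E (f : R -> \bar R) : measurable E ->
  measurable_fun setT f -> (forall x, 0 <= f x)%E ->
  (\int[cmu]_(x in E) f x = \int[mu]_(x in E) f x)%E.
Proof.
move=> mE mf f0.
have mid : measurable_fun [set: cara] (fun x : cara => x : measurableTypeR R).
  by move=> _ S mS; rewrite setTI; exact: sub_caratheodory.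
transitivity (\int[pushforward cmu (fun x : cara =>
  x : measurableTypeR R)]_(x in E) f x)%E.
  apply/esym; apply: (ge0_integral_pushforward mid) => //.
  exact: measurable_funS mf.
by apply: eq_measure_integral.
Qed.

Lemma pairing_core A0 A B0 B C0 C : borel_core A0 A -> borel_core B0 B ->
  borel_core C0 C -> finite_borel A0 -> finite_borel B0 -> finite_borel C0 ->
  ((pairing (convolution \1_A \1_B) \1_C)%:E
    = \int[mu]_(x in C0) convol A0 B0 x)%E.
Proof.
move=> cA cB cC fA fB fC.
have mphi := measurable_convol fA.1 fB.1.
have fin_phi x : convol A0 B0 x \is a fin_num.
  rewrite ge0_fin_numE ?convol_ge0//; apply: le_lt_trans fA.2.
  by apply: le_outer_measure; exact: subIsetl.
have -> : pairing (convolution \1_A \1_B) \1_C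
   = fine (\int[mu]_(x in C0) convol A0 B0 x)%E.
  rewrite /pairing /Rintegral -ge0_integral_completed//; last exact: fC.1.
  congr fine.
  transitivity (\int[cmu]_(x in C) convol A0 B0 x)%E.
    rewrite [RHS]integral_mkcond; apply: eq_integral => x _.
    rewrite (convolution_core _ cA cB fA fB) patchE indicE.
    by case: ifPn => _; rewrite ?mulr1 ?mulr0// fineK.
  have mN : (@wlength R idfun)^*%mu.-cara.-measurable (C `\` C0).
    exact/negligible_sub_caratheodory/borel_core_negligible.
  have [_ C0C [N [mN' N0 CN]]] := cC.
  rewrite (@ge0_negligible_integral _ _ _ cmu C (C `\` C0))//.
  - by rewrite setDD (setIidr C0C).
  - exact: borel_core_measurable cC.
  - exact: measurable_fun_cara.
  - apply/eqP; rewrite eq_le outer_measure_ge0 andbT -N0.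
    by apply: le_outer_measure => x [/CN []].
rewrite fineK// ge0_fin_numE; last by apply: integral_ge0 => x _; exact: convol_ge0.
apply: le_lt_trans (ltry (leb A0 * leb B0)); rewrite -integral_convol_total//.
by apply: ge0_subset_integral => //; exact: fC.1.
Qed.

End pairing.

(** * Stability *)

Section final.
Context {R : realType}.
Implicit Types (A B C E X Y S W N I : set R) (r x s t l k : R).
Local Notation mu := (@lebesgue_measure R).

(** Pollard's inequality at level t, with [C] as the test set. *)
Lemma riesz_sobolev A B C t : finite_borel A -> finite_borel B ->
  finite_borel C -> leb C = leb A + leb B - 2 * t ->
  0 < t < leb A -> t < leb B ->
  (\int[mu]_(x in C) convol A B x <= (leb A * leb B - t ^+ 2)%:E)%E.
Proof.
move=> fA fB fC cE tA tB.
have := pollard fA fB fC tA tB; have := integral_convol_setC fA fB fC.1.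
set P := (\int[mu]_(x in C) convol A B x)%E.
set Q := (\int[mu]_(x in ~` C) convol A B x)%E.
have P0 : (0 <= P)%E by apply: integral_ge0 => x _; exact: convol_ge0.
have Q0 : (0 <= Q)%E by apply: integral_ge0 => x _; exact: convol_ge0.
move: P Q P0 Q0 => [P| |] [Q| |] //= P0 Q0.
by rewrite -!EFinD !lee_fin => -[QE]; rewrite cE; lra.
Qed.

(** [sumset_stability] with n = eta m / 4 and N = m. *)
Lemma near_extremizer_near_interval A B C eta m s : finite_borel A ->
  finite_borel B -> finite_borel C -> 0 < eta -> 0 < m ->
  leb A <= m -> leb B <= m -> leb C <= m ->
  leb A + eta * m <= leb B + leb C -> leb B + eta * m <= leb A + leb C ->
  leb C + eta * m <= leb A + leb B -> 0 < s -> 120 * s <= eta * m ->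
  ((leb A * leb B - ((leb A + leb B - leb C) / 2) ^+ 2 - s ^+ 2)%:E
    <= \int[mu]_(x in C) convol A B x)%E ->
  exists I, [/\ finite_borel I, bounded_interval I & eta * leb (A `+` I) <= 864 * s].
Proof.
move=> fA fB fC eta0 m0 Am Bm Cm hA hB hC s0 sm near.
have em0 : 0 < eta * m by exact: mulr_gt0.
set t := (leb A + leb B - leb C) / 2 in near.
have tE : 2 * t = leb A + leb B - leb C by rewrite /t; lra.
have [||||X [Y [fX fY /andP[X1 X2] Yt IXY]]] := near_sumset fA fB fC _ _ _ _ near.
- lra.
- by apply/andP; split; lra.
- lra.
- by apply/andP; split; lra.
have [||||I [mI bI HI]] := @sumset_stability R A X Y s (eta * m / 4) m fA fX fY s0
  _ _ _ IXY _.
- lra.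
- by apply/andP; split; lra.
- by apply/andP; split; lra.
- lra.
exists I; split=> //; rewrite -(ler_pM2l m0); lra.
Qed.

Lemma inf_symdiff_le A (v : R) I : bounded_interval I -> leb (A `+` I) <= v ->
  inf [set leb (A `+` J) ^+ 2 | J in
    [set J : set R | bounded_interval J]] <= v ^+ 2.
Proof.
move=> bI AIv; apply: (@le_trans _ _ (leb (A `+` I) ^+ 2)).
  by apply: ge_inf; [exists 0 => _ [J _ <-]; exact: sqr_ge0|exists I].
by rewrite ler_sqr ?nnegrE ?leb_ge0// (le_trans _ AIv)// leb_ge0.
Qed.

Lemma leb_symdiff_core A0 A I : borel_core A0 A -> finite_borel A0 ->
  finite_borel I -> leb (A `+` I) <= leb (A0 `+` I).
Proof.
move=> [mA0 A0A [N [mN N0 AN]]] fA0 fI.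
have fAI : finite_borel (A0 `+` I).
  by apply: finite_borelU; [exact: finite_borelD fI.1|exact: finite_borelD fA0.1].
have le1 : (mu (A `+` I) <= mu (A0 `+` I))%E.
  rewrite -(@measureU0 _ _ R mu _ _ fAI.1 mN N0); apply: le_outer_measure => x.
  move=> [[/AN [A0x|Nx] nIx]|[Ix nAx]]; [by left; left|by right|].
  by left; right; split=> // /A0A.
rewrite /leb fine_le//.
- rewrite ge0_fin_numE; first exact: le_lt_trans le1 fAI.2.
  exact: outer_measure_ge0.
- by rewrite ge0_fin_numE; [exact: fAI.2|exact: outer_measure_ge0].
Qed.

End final.

Theorem theorem2p2 (R : realType) :
  exists K c0 : R, 0 < K /\ 0 < c0 /\
  forall (eta : R) (A B C : set R),
    0 < eta <= 1 ->
    strictly_admissible eta A B C ->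
    (exists eps : R,
      [/\ 0 <= eps, eps <= K^-1 * eta ^+ 4 &
        pairing (convolution \1_(star A) \1_(star B)) \1_(star C)
          - eps * max_leb A B C ^+ 2
        <= pairing (convolution \1_A \1_B) \1_C]) ->
    pairing (convolution \1_A \1_B) \1_C
    <= pairing (convolution \1_(star A) \1_(star B)) \1_(star C)
       - c0 * eta ^+ 2
         * inf [set leb (A `+` I) ^+ 2 | I in [set I : set R | bounded_interval I]].
Proof.
(* The constants come from [near_extremizer_near_interval]: there
   120 s <= eta m, and K = 2 * 120^2 leaves room for a deficit twice as large as
   the one allowed. *)
pose q : R := 120; have q0 : 0 < q by [].
pose K := 2 * q ^+ 2; have K0 : 0 < K by rewrite mulr_gt0// exprn_gt0.
pose v : R := 864; have v0 : 0 < v by [].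
exists K, (v ^- 2); split=> //; split; first by rewrite invr_gt0 exprn_gt0.
move=> eta A B C /andP[eta0 eta1] [fin adm] [eps [eps0 epsK near]].
pose i0 : 'I_3 := @Ordinal 3 0 isT; pose i1 : 'I_3 := @Ordinal 3 1 isT.
pose i2 : 'I_3 := @Ordinal 3 2 isT.
have [A0 [cA fA a0]] := finite_positive_core (fin i0).
have [B0 [cB fB b0]] := finite_positive_core (fin i1).
have [C0 [cC fC c0]] := finite_positive_core (fin i2).
have aE : leb A = leb A0 := borel_core_leb cA.
have bE : leb B = leb B0 := borel_core_leb cB.
have cE : leb C = leb C0 := borel_core_leb cC.
set m := max_leb A B C in near adm.
have [hC hA hB] : [/\ leb C + eta * m <= leb A + leb B,
    leb A + eta * m <= leb B + leb C & leb B + eta * m <= leb A + leb C].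
  by split; [exact: (adm i0 i1 i2)|exact: (adm i1 i2 i0)|exact: (adm i0 i2 i1)].
have [Am Bm Cm] : [/\ leb A <= m, leb B <= m & leb C <= m].
  by rewrite /m /max_leb !le_max !lexx !orbT.
rewrite aE bE cE in hA hB hC Am Bm Cm.
have m0 : 0 < m by exact: lt_le_trans Am.
have em0 : 0 < eta * m by exact: mulr_gt0.
set P := pairing (convolution \1_A _) _ in near *.
have PE := pairing_core cA cB cC fA fB fC; rewrite -/P in PE.
set Ps := pairing _ _ in near *.
set t := (leb A0 + leb B0 - leb C0) / 2.
have tE : 2 * t = leb A0 + leb B0 - leb C0 by rewrite /t; lra.
(* This makes the deficit D below, computed from a b - t^2, at most the deficit in
   the statement. *)
have PsE : leb A0 * leb B0 - t ^+ 2 <= Ps.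
  have core (S : set R) : borel_core (star S) (star S).
    by apply: borel_core_refl; exact: measurable_itv.
  have fstar (S : set R) : finite_borel (star S) by exact: finite_borel_itv.
  have := pairing_core (core A) (core B) (core C) (fstar A) (fstar B) (fstar C).
  rewrite -/Ps -lee_fin => ->; rewrite /star aE bE cE.
  apply: convol_star_lower_bound => //; lra.
have PD : P <= leb A0 * leb B0 - t ^+ 2.
  rewrite -lee_fin PE; apply: (riesz_sobolev fA fB fC); [lra|apply/andP; split;
    lra|lra].
set D := leb A0 * leb B0 - t ^+ 2 - P.
have D0 : 0 <= D by rewrite /D; lra.
have Dle : D <= (eta * m) ^+ 2 / K.
  have : D <= eps * m ^+ 2 by rewrite /D; lra.
  move=> /le_trans; apply; apply: (@le_trans _ _ (K^-1 * eta ^+ 4 * m ^+ 2)).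
    by rewrite ler_wpM2r// sqr_ge0.
  rewrite exprMn [leRHS]mulrC -mulrA ler_pM2l ?invr_gt0//.
  by rewrite ler_wpM2r ?sqr_ge0// ler_wiXn2l// ltW.
set inf_ := inf _.
suff : v ^- 2 * eta ^+ 2 * inf_ <= D by rewrite /D; lra.
apply/ler_addgt0Pr => d d0.
(* The deficit may vanish, while the error scale s must be positive: work with
   s^2 = D + d' and let d' tend to 0. The cap on d' keeps 120 s <= eta m. *)
set d' := Num.min d ((eta * m) ^+ 2 / K).
have d'0 : 0 < d' by rewrite lt_min d0 divr_gt0// exprn_gt0.
have [d'd d'm] : d' <= d /\ d' <= (eta * m) ^+ 2 / K.
  by split; rewrite ge_min lexx ?orbT.
set s := Num.sqrt (D + d').
have s0 : 0 < s by rewrite sqrtr_gt0; lra.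
have sE : s ^+ 2 = D + d' by rewrite sqr_sqrtr//; lra.
have [||I [fI bI HI]] := @near_extremizer_near_interval R A0 B0 C0 eta m s fA fB fC
  eta0 m0 Am Bm Cm hA hB hC s0 _ _.
- rewrite -ler_sqr ?nnegrE; [|lra|lra].
  rewrite -/q exprMn sE;
    apply: (@le_trans _ _ (q ^+ 2 * (2 * ((eta * m) ^+ 2 / K)))).
    by rewrite ler_pM2l ?exprn_gt0//; lra.
  by rewrite mulrCA mulrA mulrCA divff ?mulr1 ?gt_eqF.
- by rewrite -PE lee_fin -/t sE /D; lra.
have AI : leb (A `+` I) <= v * s / eta.
  rewrite ler_pdivlMr// mulrC; apply: le_trans HI.
  by rewrite ler_pM2l//; exact: leb_symdiff_core.
have := inf_symdiff_le bI AI; rewrite -/inf_ !exprMn sE => H.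
apply: (@le_trans _ _ (D + d')); last by rewrite lerD2l.
rewrite -mulrA mulrC ler_pdivrMr ?exprn_gt0//.
apply: (@le_trans _ _ (eta ^+ 2 * (v ^+ 2 * (D + d') * eta^-1 ^+ 2))).
  by rewrite ler_pM2l// exprn_gt0.
by rewrite mulrCA -exprMn divff ?gt_eqF// expr1n mulr1 mulrC.
Qed.
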